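(* Let $(p_i)_{i\in\mathbb{N}}$ be a sequence in $[0,1]$ such that $p_i\geq (i\log i)^{-1}$ for all sufficiently large $i$. Then for all $p\in(0,1)$ and all $\varepsilon\in(0,1]$, there exists a constant $K=K(p,\varepsilon,(p_i))\in\mathbb{N}$ such that $$\mathbb{P}^{K}_{p,\varepsilon}\left(W_0=\Xi\right)>0 .$$
   Context: Graph: the vertex set is $\mathbb{Z}^2$. Let $\mathcal{E}_V$ be the set of vertical edges $\{(x,y_1),(x,y_2)\}$ with $|y_1-y_2|=1$; for $i\in\mathbb{N}=\{1,2,\dots\}$ let $\mathcal{E}_{H,i}$ be the set of horizontal edges $\{(x_1,y),(x_2,y)\}$ with $|x_1-x_2|=i$. Put $\mathcal{E}=\mathcal{E}_V\cup\bigcup_{i\ge1}\mathcal{E}_{H,i}$. Measure: for $K\in\mathbb{N}$, $p\in(0,1)$, $\varepsilon\in(0,1]$ and a sequence $(p_i)$ in $[0,1]$, $\mathbb{P}^K_{p,\varepsilon}$ is the law of a pair $(\omega,\eta)\in\{0,1\}^{\mathcal{E}}\times\{0,1\}^{\mathbb{Z}^2}$ with all coordinates independent, where $\omega(e)=1$ ($e$ is open) with probability $\varepsilon$ if $e\in\mathcal{E}_V$, with probability $p_i$ if $e\in\mathcal{E}_{H,i}$ with $i\leq K$, and with probability $0$ if $e\in\mathcal{E}_{H,i}$ with $i>K$; and $\eta(v)=1$ with probability $p$, $\eta(v)=0$ with probability $1-p$, for each $v\in\mathbb{Z}^2$. Words: $\Xi=\{0,1\}^{\mathbb{N}}$; its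 elements $\xi=(\xi_1,\xi_2,\dots)$ are called words. A word $\xi$ is seen from $v\in\mathbb{Z}^2$ in $(\omega,\eta)$ if there is a sequence $v=v_0,v_1,v_2,\dots$ of pairwise distinct vertices of $\mathbb{Z}^2$ such that for all $i\geq1$: $\{v_{i-1},v_i\}\in\mathcal{E}$ has length at most $K$, $\omega(\{v_{i-1},v_i\})=1$, and $\eta(v_i)=\xi_i$ (the state of $v_0$ plays no role). $W_0$ denotes the (random) set of words seen from the origin $(0,0)$. *)

(* Defs.v *)
From HB Require Import structures.
From mathcomp Require Import all_boot all_order all_algebra finmap.
From mathcomp Require Import all_classical all_reals all_analysis.

Set Implicit Arguments.
Unset Strict Implicit.
Unset Printing Implicit Defensive.

Import Order.TTheory GRing.Theory Num.Theory.
Local Open Scope classical_set_scope.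
Local Open Scope fset_scope.
Local Open Scope ring_scope.

Definition vertex : choiceType := (int * int)%type.

Definition vertical : set {fset vertex} :=
  [set e | exists x y1 y2 : int,
     `|y1 - y2| = 1 /\ e = [fset ((x, y1) : vertex); (x, y2)]].

Definition horizontal (i : nat) : set {fset vertex} :=
  [set e | exists x1 x2 y : int,
     `|x1 - x2| = i%:Z /\ e = [fset ((x1, y) : vertex); (x2, y)]].

(* [horizontal 0] consists of singletons, hence the restriction to [0 < i]. *)
Definition edges : set {fset vertex} :=
  vertical `|` \bigcup_(i in [set i : nat | (0 < i)%N]) horizontal i.

Definition edge : choiceType := set_type edges.

Definition has_length (e : edge) (l : nat) : Prop :=
  (vertical (val e) /\ l = 1%N) \/ horizontal l (val e).

(* Letters are indexed from 0: [xi i] is the (i+1)-st letter of [xi]. *)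
Definition word := nat -> bool.

Definition seen_from (K : nat) (omega : edge -> bool) (eta : vertex -> bool)
    (v : vertex) (xi : word) : Prop :=
  exists u : nat -> vertex,
    [/\ u 0%N = v,
        injective u &
        forall i : nat,
          (exists e : edge,
             [/\ val e = [fset u i; u i.+1],
                 exists2 l : nat, has_length e l & (l <= K)%N &
                 omega e]) /\
          eta (u i.+1) = xi i].

Definition words_seen (K : nat) (omega : edge -> bool) (eta : vertex -> bool) :
    set word :=
  [set xi | seen_from K omega eta ((0, 0) : vertex) xi].

Definition mutually_independent (R : realType) (d d' : measure_display)
    (Omega : measurableType d) (T : measurableType d')
    (P : probability Omega R) (I : choiceType) (X : I -> {RV P >-> T}) : Prop :=
  forall (J : {fset I}) (B : I -> set T), (forall i, measurable (B i)) ->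
    P (\bigcap_(i in [set` J]) (X i @^-1` B i)) =
    (\prod_(i <- J) P (X i @^-1` B i))%E.

(* The pair [(omega, eta)], defined on an arbitrary probability space, has the
   law of the model truncated at range [K]; these conditions determine the
   joint law. The value [p_ 0] is irrelevant. *)
Record percolation_law (R : realType) (d : measure_display)
    (Omega : measurableType d) (P : probability Omega R)
    (K : nat) (p eps : R) (p_ : nat -> R)
    (omega : edge -> {RV P >-> bool}) (eta : vertex -> {RV P >-> bool}) :
    Prop := {
  law_independent : mutually_independent
    (fun c : edge + vertex =>
       match c with inl e => omega e | inr v => eta v end);
  law_vertical : forall e : edge, vertical (val e) ->
    P (omega e @^-1` [set true]) = eps%:E;
  law_horizontal : forall (e : edge) (i : nat), horizontal i (val e) ->
    P (omega e @^-1` [set true]) = (if (i <= K)%N then p_ i else 0)%:E;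
  law_vertex : forall v : vertex, P (eta v @^-1` [set true]) = p%:E }.

(* Main.v *)
Require Import Defs.
From HB Require Import structures.
From mathcomp Require Import all_boot all_order all_algebra finmap.
From mathcomp Require Import all_classical all_reals all_analysis.
From mathcomp Require Import zify ring lra.

(** Words are read along paths that only go right and up.  In row y a path
takes one open horizontal edge from (u, y) to (z, y), with u < z, and then the
edge from (z, y) up to (z, y+1).  So every row consumes two letters, namely
letters 2y and 2y+1, whatever the path did before, and a path is determined
by its increasing sequence of columns.  The numbers u + y are kept even and the
lengths z - u odd: then the letters that decide the passage through one row
are not looked at in any other row.

Growth.  The mass of 1/(i log i) over L <= i < L^C is about log C, so
it is as large as desired, uniformly in L, once C is large.  Hence a set of a
columns with a <= L leads, for each of the four letter pairs of the row, to at
least 8a columns of the next row along edges with lengths in that window, except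
with probability of order 1/a ([nxt_small]).  After i rows there are 4^i words
to serve, each with 8^i columns; as the sum of (4/8)^i converges,
a single column is good with probability close to 1: after H rows
every word of 2H letters can be read from it towards 8^H = L
columns ([thrives_fail]).

Coalescence.  Cut the columns into blocks wide enough to contain H steps of growth,
and the rows into levels of H+1 rows, the last of which serves to jump.  From each of the L columns
reached in a block, an edge as long as a block is open with
probability of order 1/(block length * H), and a positive fraction of the
columns of the target block is good.  So a given word fails to get from a given
good column to some good column of the target block with probability
exp(- c 8^H/H).  This beats the number exp(O(H)) of pairs made of a starting
column and a word of the level.  A block is bad if some word cannot be carried
from some good column of it to a good column in each of two blocks
of the next level; this has small probability ([bad_le]).  A route through blocks
that are not bad serves all words at once ([survives_route]).

Percolation.  It remains to find arbitrarily long oriented paths of blocks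
that are not bad, with a probability bounded below.  Bad blocks are rare and independent within each of eight
classes, so a contour argument applies ([peierls]).  Here a contour is a walk
with three kinds of steps from one corner of a site to the next one; loop
erasure makes the bad sites on it distinct, and no planar topology is involved.

All the estimates are uniform in the number of levels, and the event that every
word is seen is the decreasing limit of the events that every word of n
letters is seen, by Koenig's lemma ([words_seenE]).  This also shows that it is
measurable.  The probabilities of events that depend on finitely many bits
are computed by an elementary iterated expectation ([bexp]), to which the given
probability space is linked by [bexp_cylinder]. *)

Set Implicit Arguments.
Unset Strict Implicit.
Unset Printing Implicit Defensive.

Import Order.TTheory GRing.Theory Num.Theory.
Local Open Scope classical_set_scope.
Local Open Scope ring_scope.

(** * Expectation over finitely many independent bits *)

Section BernoulliExpectation.
Variables (R : realType) (I : eqType) (w : I -> R).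
Implicit Types (s : I -> bool) (f g : (I -> bool) -> R) (l : seq I).

Definition upd s (i : I) (b : bool) : I -> bool :=
  fun j => if j == i then b else s j.

(** Expectation of f when the bits listed in l are redrawn independently, bit i
being true with probability w i, while the other bits are those of s.  The
recursion on l turns every identity below into an induction on l. *)
Fixpoint bexp l f s : R :=
  if l is i :: l' then
    w i * bexp l' f (upd s i true) + (1 - w i) * bexp l' f (upd s i false)
  else f s.

Definition depends_on (T : Type) (D : I -> bool) (f : (I -> bool) -> T) :=
  forall s s', (forall i, D i -> s i = s' i) -> f s = f s'.

Lemma bexp_dep D l f : depends_on D f -> depends_on D (bexp l f).
Proof.
move=> fD; elim: l => [|i l IHl] //= s s' ss'.
by congr (_ * _ + _ * _); apply: IHl => j Dj; rewrite /upd; case: eqP => // _;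
  exact: ss'.
Qed.

Lemma upd_out D s i b : ~~ D i -> forall j, D j -> upd s i b j = s j.
Proof. by move=> nDi j Dj; rewrite /upd; case: eqP => // ji; rewrite -ji Dj in nDi. Qed.

Lemma bexp_cons_out D i l f s : depends_on D f -> ~~ D i ->
  bexp (i :: l) f s = bexp l f s.
Proof.
move=> fD nDi /=; rewrite !(bexp_dep l fD (upd_out s _ nDi)); ring.
Qed.

Lemma bexp_out D l f s : depends_on D f -> (forall i, i \in l -> ~~ D i) ->
  bexp l f s = f s.
Proof.
move=> fD; elim: l => // i l IHl lD.
rewrite (bexp_cons_out _ _ fD) ?lD ?mem_head//.
by apply: IHl => j jl; apply: lD; rewrite inE jl orbT.
Qed.

Lemma bexp_coord l i s : uniq l -> i \in l ->
  bexp l (fun s => (s i)%:R) s = w i.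
Proof.
elim: l s => // j l IHl s /= /andP[jl ul]; rewrite inE => /predU1P[ij|il].
  rewrite -ij in jl; rewrite -ij.
  have dep : depends_on (pred1 i) (fun s : I -> bool => (s i)%:R : R).
    by move=> t t' tt'; rewrite (tt' i (eqxx i)).
  have nl k : k \in l -> ~~ pred1 i k by move=> kl; apply: contraNneq jl => <-.
  by rewrite !(bexp_out _ dep nl) /upd !eqxx mulr1 mulr0 addr0.
by rewrite !IHl//; ring.
Qed.

Lemma bexpD l f g s : bexp l (fun s => f s + g s) s = bexp l f s + bexp l g s.
Proof. by elim: l s => //= i l IHl s; rewrite !IHl; ring. Qed.

Lemma bexpZ l (a : R) f s : bexp l (fun s => a * f s) s = a * bexp l f s.
Proof. by elim: l s => //= i l IHl s; rewrite !IHl; ring. Qed.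

Lemma bexp_cst l (a : R) s : bexp l (fun=> a) s = a.
Proof. by elim: l s => //= i l IHl s; rewrite !IHl; ring. Qed.

Lemma bexpC1 l f (a c : R) s :
  bexp l (fun s => a - c * f s) s = a - c * bexp l f s.
Proof. by rewrite -mulNr -bexpZ -[in RHS](bexp_cst l a s) -bexpD; congr bexp;
  apply/funext => t; rewrite mulNr. Qed.

Lemma bexp_sum (J : Type) (r : seq J) (Q : pred J) (F : J -> (I -> bool) -> R) l s :
  bexp l (fun s => \sum_(j <- r | Q j) F j s) s =
  \sum_(j <- r | Q j) bexp l (F j) s.
Proof.
elim: l s => //= i l IHl s; rewrite !IHl !mulr_sumr -big_split; exact: eq_bigr.
Qed.

(** Fubini on the diagonal: when the two arguments of f look at disjoint sets of
bits, reading both from one configuration amounts to reading them from two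
independent ones.  Each bit of l can be dropped from one of the two arguments. *)
Lemma bexp_diag (D1 D2 : I -> bool) l (f : (I -> bool) -> (I -> bool) -> R) s :
  (forall i, D1 i -> ~~ D2 i) ->
  (forall s', depends_on D1 (f ^~ s')) -> (forall s', depends_on D2 (f s')) ->
  bexp l (fun t => f t t) s = bexp l (fun t => bexp l (f t) s) s.
Proof.
move=> D12 f1 f2; elim: l s => // i l IHl s.
case: (boolP (D1 i)) => [/D12 nD2i|nD1i].
  have E t : bexp (i :: l) (f t) s = bexp l (f t) s by exact: bexp_cons_out nD2i.
  have -> : (fun t => bexp (i :: l) (f t) s) = (fun t => bexp l (f t) s).
    by apply/funext.
  rewrite /= !IHl; congr (_ * _ + _ * _); congr bexp; apply/funext => t;
  exact: (bexp_dep l (f2 t) (upd_out s _ nD2i)).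
have dep1 s' : depends_on D1 (fun t => bexp l (f t) s').
  by move=> t t' tt'; congr bexp; apply/funext => t0; exact: f1.
have dep2 : depends_on D1 (fun t => bexp (i :: l) (f t) s).
  by move=> t t' tt'; congr bexp; apply/funext => t0; exact: f1.
rewrite (bexp_cons_out _ _ dep2 nD1i) /= bexpD !bexpZ !IHl.
by congr (_ * _ + _ * _); exact: (bexp_dep l (dep1 _) (upd_out s _ nD1i)).
Qed.

Lemma bexpM (D1 D2 : I -> bool) l f g s :
  (forall i, D1 i -> ~~ D2 i) -> depends_on D1 f -> depends_on D2 g ->
  bexp l (fun t => f t * g t) s = bexp l f s * bexp l g s.
Proof.
move=> D12 fD gD; rewrite (bexp_diag l (f := fun t t' => f t * g t') s D12).
- rewrite [RHS]mulrC -bexpZ; congr bexp; apply/funext => t.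
  by rewrite bexpZ mulrC.
- by move=> s' t t' tt'; rewrite (fD t t').
- by move=> s' t t' tt'; rewrite (gD t t').
Qed.

Lemma bexp_prod (J : eqType) (r : seq J) (D : J -> I -> bool)
    (F : J -> (I -> bool) -> R) l s :
  uniq r -> (forall j, j \in r -> depends_on (D j) (F j)) ->
  (forall j j' i, j \in r -> j' \in r -> j != j' -> D j i -> ~~ D j' i) ->
  bexp l (fun s => \prod_(j <- r) F j s) s = \prod_(j <- r) bexp l (F j) s.
Proof.
elim: r => [_ _ _|j r IHr /= /andP[jr ur] FD DD].
  by rewrite big_nil; under [X in bexp _ X]eq_fun do rewrite big_nil; rewrite bexp_cst.
under [X in bexp _ X]eq_fun do rewrite big_cons.
rewrite big_cons (@bexpM (D j) (fun i => has (fun k => D k i) r)).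
- congr (_ * _); apply: IHr => //.
    by move=> k kr; apply: FD; rewrite inE kr orbT.
  by move=> k k' i kr k'r; apply: DD; rewrite inE ?kr ?k'r orbT.
- move=> i Dji; apply/hasPn => k kr; apply: DD Dji.
  + exact: mem_head.
  + by rewrite inE kr orbT.
  + by apply: contraNneq jr => ->.
- by apply: FD; exact: mem_head.
- move=> t t' tt'; apply: eq_big_seq => k kr; apply: FD; first by rewrite inE kr orbT.
  by move=> i Dki; apply: tt'; apply/hasP; exists k.
Qed.

Hypothesis w01 : forall i, 0 <= w i <= 1.

Lemma ler_bexp l f g s : (forall t, f t <= g t) -> bexp l f s <= bexp l g s.
Proof.
move=> fg; elim: l s => [|i l IHl] s //=.
by have /andP[w0 w1] := w01 i; rewrite lerD ?ler_wpM2l ?subr_ge0.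
Qed.

Lemma bexp_ge0 l f s : (forall t, 0 <= f t) -> 0 <= bexp l f s.
Proof. by move=> f0; rewrite -(bexp_cst l 0 s); exact: ler_bexp. Qed.

Lemma bexp_le l f s (a : R) : (forall t, f t <= a) -> bexp l f s <= a.
Proof. by move=> fa; rewrite -(bexp_cst l a s); exact: ler_bexp. Qed.

(** Conditioning: the first argument of f stands for the past, and a bound that
holds for each fixed past survives averaging over the past. *)
Lemma bexp_cond (D1 D2 : I -> bool) l (f : (I -> bool) -> (I -> bool) -> R) s (a : R) :
  (forall i, D1 i -> ~~ D2 i) ->
  (forall s', depends_on D1 (f ^~ s')) -> (forall s', depends_on D2 (f s')) ->
  (forall t, bexp l (f t) s <= a) ->
  bexp l (fun t => f t t) s <= a.
Proof. by move=> D12 f1 f2 fa; rewrite (bexp_diag l s D12 f1 f2); exact: bexp_le. Qed.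

End BernoulliExpectation.

(** * Columns hit from a given set of columns *)

(** The bits that a path going right and up can meet: the letter at (x, y), the edge
from (x, y) to (x, y+1), and the edge of row y between columns u and z. *)
Inductive coord := Site of nat & nat | Rise of nat & nat | Run of nat & nat & nat.

HB.instance Definition _ := gen_eqMixin coord.

(** The bits that decide whether column z is hit in a given row all have target z,
so that distinct columns are hit independently. *)
Definition target (c : coord) : nat :=
  match c with Site x _ => x | Rise x _ => x | Run _ _ z => z end.

Definition is_run (c : coord) : bool := if c is Run _ _ _ then true else false.

Definition config := coord -> bool.

(** The parity condition keeps apart the letters used in different rows: the letter
at (z, y+1) is read at the end of row y when z + y is odd, and as a horizontal
arrival in row y+1 when z + y is even. *)
Definition marked (s : config) (y : nat) (ab : bool * bool) (z : nat) : bool :=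
  [&& odd (z + y), s (Site z y) == ab.1, s (Rise z y) & s (Site z y.+1) == ab.2].

Definition hit (s : config) (y : nat) (win : nat -> nat -> bool)
    (ab : bool * bool) (A : seq nat) (z : nat) : bool :=
  marked s y ab z && has (fun u => win u z && s (Run y u z)) A.

Lemma prod_1B_le (R : realFieldType) (J : Type) (r : seq J) (x : J -> R) :
  (forall j, 0 <= x j <= 1) ->
  (\prod_(j <- r) (1 - x j)) * (1 + \sum_(j <- r) x j) <= 1.
Proof.
move=> x01; elim: r => [|j r IHr]; first by rewrite !big_nil addr0 mulr1.
rewrite !big_cons; have /andP[x0 x1] := x01 j.
set P := \prod_(_ <- _) _ in IHr *; set S := \sum_(_ <- _) _ in IHr *.
have P0 : 0 <= P.
  by apply: prodr_ge0 => k _; rewrite subr_ge0; case/andP: (x01 k).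
have S0 : 0 <= S by apply: sumr_ge0 => k _; case/andP: (x01 k).
have : 0 <= P * (x j * S + x j * x j) by rewrite mulr_ge0// addr_ge0 ?mulr_ge0.
by nra.
Qed.

(** One of several independent events of small total probability occurs with at
least half that total probability, because the product of the 1 - x j is at
most 1 / (1 + sum of the x j). *)
Lemma prod_1B_half (R : realFieldType) (J : Type) (r : seq J) (x : J -> R) :
  (forall j, 0 <= x j <= 1) -> \sum_(j <- r) x j <= 1 ->
  (\sum_(j <- r) x j) / 2 <= 1 - \prod_(j <- r) (1 - x j).
Proof.
move=> x01 S1; have := prod_1B_le r x01.
set P := \prod_(_ <- _) _; set S := \sum_(_ <- _) _ in S1 *.
have S0 : 0 <= S by apply: sumr_ge0 => k _; case/andP: (x01 k).
have P0 : 0 <= P.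
  by apply: prodr_ge0 => k _; rewrite subr_ge0; case/andP: (x01 k).
move=> h; have : P <= 1 - S / 2; last by lra.
have : (1 - S / 2) * (1 + S) >= 1 by nra.
by move=> h2; have := le_trans h h2; rewrite ler_pM2r//; lra.
Qed.

Lemma prod_1B_exp (R : realType) (J : eqType) (r : seq J) (x : J -> R) :
  (forall j, j \in r -> x j <= 1) ->
  \prod_(j <- r) (1 - x j) <= expR (- \sum_(j <- r) x j).
Proof.
move=> x1; rewrite -sumrN big_seq [in leRHS]big_seq expR_sum; apply: ler_prod => j jr.
by rewrite subr_ge0 x1//= expR_ge1Dx.
Qed.

Section Hits.
Variables (R : realType) (p eps : R) (p_ : nat -> R).
Hypothesis p01 : 0 < p < 1.
Hypothesis eps01 : 0 < eps <= 1.
Hypothesis p_01 : forall i, (0 < i)%N -> 0 <= p_ i <= 1.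

Definition weight (c : coord) : R :=
  match c with
  | Site _ _ => p
  | Rise _ _ => eps
  | Run _ u z => if (u < z)%N then p_ (z - u) else 0
  end.

Lemma weight01 c : 0 <= weight c <= 1.
Proof.
case: c => [x y|x y|y u z] /=.
- by case/andP: p01 => /ltW -> /ltW ->.
- by case/andP: eps01 => /ltW -> ->.
- by case: ifP => [uz|_]; [apply: p_01; rewrite subn_gt0|rewrite lexx ler01].
Qed.

Definition mark_rate : R := eps * Num.min p (1 - p) ^+ 2.

Lemma mark_rate_gt0 : 0 < mark_rate.
Proof.
have /andP[e0 _] := eps01; have /andP[p0 p1] := p01.
by rewrite mulr_gt0 ?exprn_gt0 ?lt_min ?subr_gt0 ?p0.
Qed.

Variable l : seq coord.
Hypothesis ul : uniq l.

Local Notation E f := (bexp weight l f (fun=> false)).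

Lemma bexp_bit c b : c \in l ->
  E (fun s => (s c == b)%:R) = if b then weight c else 1 - weight c.
Proof.
move=> cl; case: b.
  rewrite -(bexp_coord weight (fun=> false) ul cl); congr bexp; apply/funext => s.
  by case: (s c).
rewrite -(bexp_coord weight (fun=> false) ul cl) -[X in _ = _ - X]mul1r -bexpC1.
by congr bexp; apply/funext => s; case: (s c); rewrite /= mul1r ?subrr ?subr0.
Qed.

Lemma bit_dep c b : depends_on (pred1 c) (fun s : config => (s c == b)%:R : R).
Proof. by move=> s s' ss'; rewrite (ss' c (eqxx c)). Qed.

Lemma bexp_marked y ab z : odd (z + y) ->
  Site z y \in l -> Rise z y \in l -> Site z y.+1 \in l ->
  mark_rate <= E (fun s => (marked s y ab z)%:R).
Proof.
move=> ozy l1 l2 l3.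
have -> : (fun s : config => (marked s y ab z)%:R : R) =
  (fun s => (s (Site z y) == ab.1)%:R *
     ((s (Rise z y) == true)%:R * (s (Site z y.+1) == ab.2)%:R)).
  by apply/funext => s; rewrite /marked ozy /= -!natrM !mulnb eqb_id.
rewrite (@bexpM _ _ _ (pred1 (Site z y)) (fun c => (c == Rise z y) || (c == Site z y.+1))).
- rewrite (@bexpM _ _ _ (pred1 (Rise z y)) (pred1 (Site z y.+1))).
  + rewrite !bexp_bit//= /mark_rate.
    have /andP[e0 e1] := eps01; have /andP[p0 p1] := p01.
    have h b : Num.min p (1 - p) <= (if b then p else 1 - p).
      by case: b; rewrite ge_min lexx ?orbT.
    have m0 : 0 <= Num.min p (1 - p) by rewrite le_min subr_ge0 !ltW.
    rewrite [leRHS]mulrCA ler_wpM2l ?(ltW e0)// expr2.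
    by apply: ler_pM.
  + by move=> c /= /eqP ->; apply/eqP.
  + exact: bit_dep.
  + exact: bit_dep.
- by move=> c /= /eqP ->; apply/negP => /orP[/eqP//|/eqP[]]; lia.
- exact: bit_dep.
- by move=> s s' ss'; rewrite !ss'// eqxx ?orbT.
Qed.

Lemma marked_dep y ab z :
  depends_on (fun c => ~~ is_run c && (target c == z)) (fun s => marked s y ab z).
Proof. by move=> s s' ss'; rewrite /marked !ss'//= eqxx. Qed.

Lemma hit_dep y win ab A z :
  depends_on (fun c => target c == z) (fun s => hit s y win ab A z).
Proof.
move=> s s' ss'; rewrite /hit; congr (_ && _).
  by apply: marked_dep => c /andP[_ cz]; exact: ss'.
by apply: eq_has => u; rewrite (ss' (Run y u z))//= eqxx.
Qed.

(** Only lower bounds r of the p_ i enter, although the probability of a hit is not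
linear in them: it is monotone in the p_ i, and linear up to a factor 2 when the
total of r is at most 1. *)
Lemma bexp_hit y (win : nat -> nat -> bool) ab A z (r : nat -> nat -> R) :
  uniq A -> odd (z + y) ->
  Site z y \in l -> Rise z y \in l -> Site z y.+1 \in l ->
  (forall u, u \in A -> win u z ->
     [/\ (u < z)%N, Run y u z \in l & 0 <= r u z <= p_ (z - u)]) ->
  \sum_(u <- A | win u z) r u z <= 1 ->
  mark_rate * (\sum_(u <- A | win u z) r u z) / 2 <=
  E (fun s => (hit s y win ab A z)%:R).
Proof.
move=> uA ozy l1 l2 l3 Awin S1.
have -> : (fun s : config => (hit s y win ab A z)%:R : R) =
  (fun s => (marked s y ab z)%:R * (has (fun u => win u z && s (Run y u z)) A)%:R).
  by apply/funext => s; rewrite /hit -natrM mulnb.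
rewrite (@bexpM _ _ _ (fun c => ~~ is_run c && (target c == z)) is_run); first last.
- by move=> s s' ss'; congr (_ %:R); congr (nat_of_bool _);
    apply: eq_has => u; rewrite (ss' (Run y u z)).
- by move=> s s' ss'; rewrite (marked_dep y ab ss').
- by move=> c /andP[].
have -> : (fun s : config => (has (fun u => win u z && s (Run y u z)) A)%:R : R) =
   (fun s => 1 - 1 * \prod_(u <- A) (~~ (win u z && s (Run y u z)))%:R).
  apply/funext => s; rewrite mul1r; elim: (A) => [|u B IHB] /=.
    by rewrite big_nil subrr.
  rewrite big_cons; case: (_ && _) => /=; first by rewrite mul0r subr0.
  by rewrite mul1r IHB.
rewrite bexpC1 mul1r -mulrA; apply: ler_pM.
- exact: ltW mark_rate_gt0.
- by rewrite divr_ge0// big_seq_cond sumr_ge0// => u /andP[uA'] /(Awin _ uA')[_ _ /andP[]].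
- exact: bexp_marked.
rewrite (@bexp_prod _ _ _ _ _ (fun u => pred1 (Run y u z)))//; first last.
- move=> u v c _ _ uv /= /eqP ->; apply/eqP => -[] vu.
  by rewrite vu eqxx in uv.
- by move=> u _ s s' ss'; rewrite (ss' (Run y u z) (eqxx _)).
have Eu u : u \in A -> E (fun s => (~~ (win u z && s (Run y u z)))%:R) =
    1 - (if win u z then p_ (z - u) else 0).
  move=> uA'; case: ifP => [wuz|_] /=; last by rewrite bexp_cst subr0.
  have [uz lu _] := Awin u uA' wuz.
  have := bexp_bit false lu; rewrite /= uz => <-.
  by congr bexp; apply/funext => s; case: (s _).
rewrite (eq_big_seq _ Eu) big_mkcond /=.
set x := fun u => if win u z && (u \in A) then r u z else 0.
have -> : \sum_(u <- A) (if win u z then r u z else 0) = \sum_(u <- A) x u.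
  by apply: eq_big_seq => u uA'; rewrite /x uA' andbT.
apply: le_trans (prod_1B_half _ _) _.
- move=> u; rewrite /x; case: ifP => [/andP[wu uA']|]; last by rewrite lexx ler01.
  have [uz _ /andP[-> rp]] := Awin u uA' wu; apply: le_trans rp _.
  by have /p_01/andP[] : (0 < z - u)%N by rewrite subn_gt0.
- apply: le_trans S1; rewrite [leRHS]big_mkcond [leLHS]big_seq [leRHS]big_seq.
  apply: ler_sum => u uA'.
  by rewrite /x uA' andbT.
rewrite lerB// [leLHS]big_seq [leRHS]big_seq ler_prod// => u uA'.
rewrite /x uA' andbT; case: ifP => [wu|_]; last by rewrite subr0 ler01 lexx.
have [uz _ /andP[r0 rp]] := Awin u uA' wu.
have /p_01/andP[_ p1] : (0 < z - u)%N by rewrite subn_gt0.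
by rewrite subr_ge0 p1 lerB.
Qed.

(** For c = 1 this bounds the probability that no column of zs is hit; for c = 1/2
the product is 2 to the power minus the number of hits, and the bound is a
Chernoff estimate. *)
Lemma bexp_hits y (win : nat -> nat -> bool) ab A zs (r : nat -> nat -> R) (c : R) :
  0 <= c <= 1 -> uniq A -> uniq zs ->
  (forall z, z \in zs ->
   [/\ odd (z + y), Site z y \in l, Rise z y \in l & Site z y.+1 \in l]) ->
  (forall u z, u \in A -> z \in zs -> win u z ->
     [/\ (u < z)%N, Run y u z \in l & 0 <= r u z <= p_ (z - u)]) ->
  (forall z, z \in zs -> \sum_(u <- A | win u z) r u z <= 1) ->
  E (fun s => \prod_(z <- zs) (1 - c * (hit s y win ab A z)%:R)) <=
  expR (- (c * mark_rate / 2 * \sum_(z <- zs) \sum_(u <- A | win u z) r u z)).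
Proof.
move=> /andP[c0 c1] uA uzs lz Awin S1.
rewrite (@bexp_prod _ _ _ _ _ (fun z c => target c == z))//; first last.
- by move=> z z' i _ _ zz' /eqP ->.
- by move=> z _ s s' ss'; rewrite (hit_dep y win ab A ss').
set pi := fun z => E (fun s => (hit s y win ab A z)%:R).
have -> : \prod_(z <- zs) E (fun s => 1 - c * (hit s y win ab A z)%:R) =
    \prod_(z <- zs) (1 - c * pi z).
  by apply: eq_bigr => z _; rewrite bexpC1.
have pi01 z : 0 <= pi z <= 1.
  by rewrite bexp_ge0 ?bexp_le//; [exact: weight01|move=> t; case: hit|exact: weight01].
apply: le_trans (prod_1B_exp _) _.
  by move=> z _; have /andP[pi0 pi1] := pi01 z; rewrite mulr_ile1.
rewrite ler_expR lerN2 mulr_sumr [leLHS]big_seq [leRHS]big_seq; apply: ler_sum => z zzs.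
have [ozy l1 l2 l3] := lz z zzs.
have := @bexp_hit y win ab A z r uA ozy l1 l2 l3 (fun u uA' => @Awin u z uA' zzs) (S1 z zzs).
rewrite -/(pi z) => h; apply: le_trans (ler_wpM2l c0 h).
by rewrite le_eqVlt; apply/orP; left; apply/eqP; ring.
Qed.

End Hits.

(** * Growth of the set of reachable columns *)

Definition column (c : coord) : nat :=
  match c with Site x _ => x | Rise x _ => x | Run _ u _ => u end.

(** The row in which a bit can be used.  A letter is used in the row of its vertex or in
the row below, according to parity. *)
Definition row (c : coord) : nat :=
  match c with
  | Site x y => if odd (x + y) then y else y.-1
  | Rise _ y => y
  | Run y _ _ => y
  end.

Definition box (X Y : nat) : seq coord :=
  undup ([seq Site x y | x <- iota 0 X, y <- iota 0 Y] ++
         [seq Rise x y | x <- iota 0 X, y <- iota 0 Y] ++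
         [seq Run y uz.1 uz.2 | y <- iota 0 Y.-1,
            uz <- [seq (u, z) | z <- iota 0 X, u <- iota 0 z]]).

Lemma box_uniq X Y : uniq (box X Y). Proof. exact: undup_uniq. Qed.

Lemma mem_box X Y c : (c \in box X Y) =
  match c with
  | Site x y => (x < X)%N && (y < Y)%N
  | Rise x y => (x < X)%N && (y < Y)%N
  | Run y u z => [&& (u < z)%N, (z < X)%N & (y.+1 < Y)%N]
  end.
Proof.
rewrite mem_undup !mem_cat; case: c => [x y|x y|y u z].
- apply/idP/idP.
    case/or3P => /allpairsP[[a b] /= [ha hb E]]; case: E => // -> ->.
    by move: ha hb; rewrite !mem_iota !add0n /= => -> ->.
  move=> /andP[xX yY]; apply/orP; left; apply/allpairsP; exists (x, y).
  by rewrite !mem_iota.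
- apply/idP/idP.
    case/or3P => /allpairsP[[a b] /= [ha hb E]]; case: E => // -> ->.
    by move: ha hb; rewrite !mem_iota !add0n /= => -> ->.
  move=> /andP[xX yY]; apply/or3P; apply: Or32; apply/allpairsP; exists (x, y).
  by rewrite !mem_iota.
- apply/idP/idP.
    case/or3P => /allpairsP[[a b] /= [ha hb E]]; case: E => // -> -> ->.
    move: hb => /allpairsPdep[z' [u' [hz hu ->]]].
    move: ha hz hu; rewrite !mem_iota !add0n /= => ha -> ->.
    by rewrite -ltn_predRL.
  move=> /and3P[uz zX yY]; apply/or3P; apply: Or33; apply/allpairsP.
  exists (y, (u, z)); split => //=; first by rewrite mem_iota add0n /= ltn_predRL.
  by apply/allpairsPdep; exists z, u; rewrite !mem_iota.
Qed.

Lemma marked_eq (s s' : config) y ab z :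
  (forall c, column c = z -> row c = y -> s c = s' c) ->
  marked s y ab z = marked s' y ab z.
Proof.
move=> ss'; rewrite /marked; case: (boolP (odd (z + y))) => //= ozy.
by rewrite !ss'//= ?ozy// addnS /= ozy.
Qed.

Lemma hit_eq (s s' : config) y win ab A z :
  (forall c, column c = z -> row c = y -> s c = s' c) ->
  (forall c, column c \in A -> row c = y -> s c = s' c) ->
  hit s y win ab A z = hit s' y win ab A z.
Proof.
move=> ss' As; rewrite /hit (marked_eq ab ss'); congr (_ && _).
by apply: eq_in_has => u uA; rewrite As.
Qed.

Section Growth.
Variables (L M B : nat).

Definition in_window (u z : nat) : bool := odd (z - u) && (L <= z - u < M)%N.

Definition cols (j : nat) : seq nat := iota (j * B) B.

(** Truncating at eight times the size of A makes the sizes along a growth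
deterministic, as long as it succeeds. *)
Definition nxt (j : nat) (s : config) (y : nat) (ab : bool * bool) (A : seq nat) :=
  take (8 * size A) [seq z <- cols j | hit s y in_window ab A z].

(** Quantifying over letter pairs inside the recursion serves all words at once.  Any
factor above 4, the number of letter pairs of a row, would do instead of 8. *)
Fixpoint thrives (j : nat) (s : config) (y : nat) (A : seq nat) (n : nat) : bool :=
  if n is n'.+1 then
    [forall ab : bool * bool, (size (nxt j s y ab A) == 8 * size A)%N &&
       thrives j s y.+1 (nxt j s y ab A) n']
  else true.

Fixpoint grow (j : nat) (s : config) (y : nat) (A : seq nat) (w : seq (bool * bool)) :=
  if w is ab :: w' then grow j s y.+1 (nxt j s y ab A) w' else A.

(** The room n * M on the right keeps n more rows of growth inside block j, so that
growths started in different blocks look at different bits. *)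
Definition seeds (j y n : nat) (A : seq nat) :=
  uniq A /\ forall u, u \in A ->
    [/\ (j * B <= u)%N, (u + n * M < j.+1 * B)%N & ~~ odd (u + y)].

Lemma mem_cols j z : (z \in cols j) = (j * B <= z < j.+1 * B)%N.
Proof. by rewrite mem_iota mulSn [(B + _)%N]addnC. Qed.

Lemma cols_div j z : z \in cols j -> (z %/ B)%N = j.
Proof.
rewrite mem_cols => /andP[jz zj]; have B0 : (0 < B)%N by lia.
by apply/eqP; rewrite eqn_leq -ltnS ltn_divLR// zj leq_divRL.
Qed.

Lemma nxt_cols j s y ab A : {subset nxt j s y ab A <= cols j}.
Proof. by move=> z /mem_take; rewrite mem_filter => /andP[]. Qed.

Lemma nxt_hit j s y ab A z : z \in nxt j s y ab A -> hit s y in_window ab A z.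
Proof. by move=> /mem_take; rewrite mem_filter => /andP[]. Qed.

Lemma nxt_seeds j s y ab n A : seeds j y n.+1 A -> seeds j y.+1 n (nxt j s y ab A).
Proof.
move=> [uA hA]; split; first by rewrite take_uniq// filter_uniq// iota_uniq.
move=> z zA; have := nxt_hit zA => /andP[/and4P[ozy _ _ _] /hasP[u uA' /andP[wu _]]].
have [ju uj ouy] := hA u uA'; move: wu => /andP[_ /andP[Lz zM]].
have := nxt_cols zA; rewrite mem_cols => /andP[-> _]; split => //.
- by rewrite mulSn in uj; lia.
- by rewrite addnS /= ozy.
Qed.

Lemma seeds_cols j y n A : seeds j y n A -> {subset A <= cols j}.
Proof.
by move=> [_ hA] u /hA[ju uj _]; rewrite mem_cols ju /=; lia.
Qed.

Lemma size_grow j s y A w : thrives j s y A (size w) ->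
  size (grow j s y A w) = (8 ^ size w * size A)%N.
Proof.
elim: w y A => [|ab w IHw] y A /=; first by rewrite mul1n.
by move=> /forallP/(_ ab)/andP[/eqP h /IHw ->]; rewrite h expnS; lia.
Qed.

Lemma grow_seeds j s y n A w :
  seeds j y (size w + n) A -> seeds j (y + size w) n (grow j s y A w).
Proof.
elim: w y A => [|ab w IHw] y A /=; first by rewrite addn0.
by rewrite addnS -addSn => /nxt_seeds h; apply: IHw; exact: h.
Qed.

Lemma nxt_eq j (s s' : config) y ab A : {subset A <= cols j} ->
  (forall c, (column c %/ B)%N = j -> row c = y -> s c = s' c) ->
  nxt j s y ab A = nxt j s' y ab A.
Proof.
move=> Aj ss'; congr take; apply: eq_in_filter => z zj; apply: hit_eq => c.
  by move=> cz; apply: ss'; rewrite cz; exact: cols_div.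
by move=> cA; apply: ss'; apply: cols_div; exact: Aj.
Qed.

Lemma thrives_eq j (s s' : config) y n A : {subset A <= cols j} ->
  (forall c, (column c %/ B)%N = j -> (y <= row c < y + n)%N -> s c = s' c) ->
  thrives j s y A n = thrives j s' y A n.
Proof.
elim: n y A => [|n IHn] y A //= Aj ss'; apply: eq_forallb => ab.
rewrite (@nxt_eq j s s')//; last by move=> c cj cy; apply: ss' => //; lia.
congr (_ && _); apply: IHn; first exact: nxt_cols.
by move=> c cj cy; apply: ss' => //; lia.
Qed.

Lemma grow_eq j (s s' : config) y A w : {subset A <= cols j} ->
  (forall c, (column c %/ B)%N = j -> (y <= row c < y + size w)%N -> s c = s' c) ->
  grow j s y A w = grow j s' y A w.
Proof.
elim: w y A => [|ab w IHw] y A //= Aj ss'.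
rewrite (@nxt_eq j s s')//; last by move=> c cj cy; apply: ss' => //; lia.
apply: IHw; first exact: nxt_cols.
by move=> c cj cy; apply: ss' => //; lia.
Qed.

Lemma grow_cols j s y A w : {subset A <= cols j} ->
  {subset grow j s y A w <= cols j}.
Proof.
by elim: w y A => [|ab w IHw] y A //= _; apply: IHw; exact: nxt_cols.
Qed.

End Growth.

(** A lower bound of 1/(i log i), for i > 1, in which the logarithm is replaced by
the number of binary digits of i. *)
Definition rate (R : realType) (i : nat) : R := (i * (trunc_log 2 i).+1)%:R^-1.

Lemma rate_ge0 (R : realType) i : 0 <= rate R i.
Proof. by rewrite invr_ge0. Qed.

Lemma rate_le (R : realType) i k : (0 < k)%N -> (k <= i)%N -> rate R i <= k%:R^-1.
Proof.
move=> k0 ki; rewrite /rate lef_pV2 ?posrE ?ltr0n ?muln_gt0//; last by lia.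
by rewrite ler_nat; nia.
Qed.

Lemma prod_half (R : realFieldType) (b : nat -> bool) (zs : seq nat) :
  \prod_(z <- zs) (1 - 2^-1 * (b z)%:R) = 2^-1 ^+ count b zs :> R.
Proof.
elim: zs => [|z zs IHz]; first by rewrite big_nil.
rewrite big_cons IHz /=; case: (b z); last by rewrite mulr0 subr0 mul1r.
by rewrite exprS mulr1; congr (_ * _); lra.
Qed.

Section GrowthProbability.
Variables (R : realType) (p eps : R) (p_ : nat -> R).
Hypothesis p01 : 0 < p < 1.
Hypothesis eps01 : 0 < eps <= 1.
Hypothesis p_01 : forall i, (0 < i)%N -> 0 <= p_ i <= 1.

Local Notation q := (mark_rate p eps).

Variables (L M B : nat).
Hypothesis L0 : (0 < L)%N.

Local Notation in_window := (in_window L M).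
Local Notation cols := (cols B).
Local Notation nxt := (nxt L M B).
Local Notation thrives := (thrives L M B).
Local Notation seeds := (seeds M B).
Local Notation rate := (rate R).

Hypothesis rate_p : forall i, (L <= i < M)%N -> rate i <= p_ i.
Variables (m lam : R).
Hypothesis lam0 : 0 < lam.
Hypothesis lam_m : lam + 8 <= q * m / 4.
Hypothesis mass : m <= \sum_(0 <= i < M | odd i && (L <= i)%N) rate i.

Variables (X Y : nat).

Local Notation E f := (bexp (weight p eps p_) (box X Y) f (fun=> false)).

Lemma window_mass j u : (j * B <= u)%N -> (u + M <= j.+1 * B)%N ->
  m <= \sum_(z <- cols j | in_window u z) rate (z - u).
Proof.
move=> ju uj; apply: le_trans mass _.
have -> : cols j = index_iota (j * B) (j.+1 * B).
  by rewrite /index_iota /cols; congr iota; lia.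
rewrite [leRHS](@big_cat_nat _ _ _ u)//=; last by lia.
rewrite [X in _ <= _ + X](@big_cat_nat _ _ _ (u + M) u)//=; last by lia.
rewrite -[leLHS]add0r lerD ?sumr_ge0//; first by move=> *; exact: rate_ge0.
rewrite -[leLHS]addr0 lerD ?sumr_ge0//; last by move=> *; exact: rate_ge0.
rewrite [leRHS](_ : _ = \sum_(0 + u <= z < u + M | in_window u z) rate (z - u));
  last by rewrite add0n.
rewrite big_addn addKn le_eqVlt; apply/orP; left; apply/eqP.
rewrite big_nat_cond [in RHS]big_nat_cond; apply: eq_big => i.
  by rewrite /in_window addnK /=; case: (i < M)%N; rewrite //= andbT.
by rewrite addnK.
Qed.

Lemma window_sum_le1 z A : (size A <= L)%N ->
  \sum_(u <- A | in_window u z) rate (z - u) <= 1.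
Proof.
move=> AL; apply: (@le_trans _ _ (\sum_(u <- A | in_window u z) L%:R^-1)).
  by apply: ler_sum => u /andP[_ /andP[Lz _]]; exact: rate_le.
rewrite big_const_seq iter_addr addr0 -[leLHS]mulr_natl ler_pdivrMr ?ltr0n// mul1r ler_nat.
by apply: leq_trans AL; exact: count_size.
Qed.

(** The expected number of hits is at least q m a / 2 with a the size of A.  A
Chernoff estimate bounds the probability of fewer than 8a hits by
2^(8a) exp(- q m a / 4) <= exp(- lam a) <= 1 / (lam a). *)
Lemma nxt_small j y n ab A : (0 < size A)%N -> (size A <= L)%N ->
  seeds j y n.+1 A -> (j.+1 * B <= X)%N -> (y.+1 < Y)%N ->
  E (fun s => (size (nxt j s y ab A) != 8 * size A)%N%:R) <=
    (lam * (size A)%:R)^-1.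
Proof.
move=> A0 AL [uA hA] jX yY.
set a := size A in A0 AL *.
pose zs := [seq z <- cols j | odd (z + y)].
have Fz s : [seq z <- cols j | hit s y in_window ab A z] =
    [seq z <- zs | hit s y in_window ab A z].
  rewrite -filter_predI; apply: eq_filter => z /=.
  by rewrite /hit /marked; case: odd; rewrite ?andbT.
(* If there are fewer than 8a hits then 2^(8a - number of hits) >= 1. *)
have cnt s : (size (nxt j s y ab A) != 8 * a)%N%:R <=
    2 ^+ (8 * a) * \prod_(z <- zs) (1 - 2^-1 * (hit s y in_window ab A z)%:R) :> R.
  rewrite prod_half; case: eqP => /= [_|].
    by rewrite mulr_ge0 ?exprn_ge0.
  rewrite /nxt Fz size_take size_filter; case: ltnP => // h _.
  rewrite -(subnK h) exprD -mulrA -exprMn divff// expr1n mulr1.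
  by rewrite exprn_ege1// ler1n.
apply: le_trans (ler_bexp (weight01 p01 eps01 p_01) _ _ cnt) _.
rewrite bexpZ.
have zsP z : z \in zs -> [/\ odd (z + y), (z < X)%N & z \in cols j].
  by rewrite mem_filter => /andP[-> zj]; split=> //; move: zj jX; rewrite mem_cols; clear; lia.
pose S := \sum_(z <- zs) \sum_(u <- A | in_window u z) rate (z - u).
have hits_le : E (fun s => \prod_(z <- zs) (1 - 2^-1 * (hit s y in_window ab A z)%:R)) <=
    expR (- (2^-1 * q / 2 * S)).
  apply: (@bexp_hits _ _ _ _ p01 eps01 p_01 _ (box_uniq X Y) _ _ _ _ _
    (fun u z => rate (z - u))) => //.
  - by apply/andP; split; lra.
  - by rewrite filter_uniq// iota_uniq.
  - by move=> z /zsP[ozy zX _]; rewrite !mem_box; clear - ozy zX yY; split => //; lia.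
  - move=> u z uA' /zsP[_ zX _] /andP[_ /andP[Lz zM]]; rewrite mem_box.
    split; [by clear - L0 Lz; lia|by clear - L0 Lz zX yY; lia|].
    by rewrite rate_ge0 rate_p// Lz.
  - by move=> z _; exact: window_sum_le1.
apply: le_trans (ler_wpM2l _ hits_le) _; first by rewrite exprn_ge0.

have mS : m * a%:R <= S.
  have -> : S = \sum_(u <- A) \sum_(z <- zs | in_window u z) rate (z - u).
    rewrite /S; under eq_bigr do rewrite big_mkcond; rewrite exchange_big /=.
    by apply: eq_bigr => u _; rewrite [RHS]big_mkcond.
  rewrite mulr_natr -[X in X <= _]addr0 -iter_addr -[a](count_predT A) -big_const_seq.
  rewrite [leLHS]big_seq [leRHS]big_seq; apply: ler_sum => u uA'.
  have [ju uj ouy] := hA u uA'.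
  apply: le_trans (window_mass ju _) _; first by rewrite mulSn in uj; clear - uj; lia.
  rewrite big_filter_cond /= le_eqVlt; apply/orP; left; apply/eqP.
  apply: eq_bigl => z; rewrite /in_window andbC.
  case: (boolP (odd (z - u))) => [oz|_]; rewrite /= ?andbF//.
  case: (boolP (L <= z - u < M)%N) => [Lz|_]; rewrite /= ?andbF// andbT.
  by move: oz ouy; rewrite oddB ?oddD; [case: odd; case: odd; case: odd|clear - L0 Lz; lia].
have q0 := mark_rate_gt0 p01 eps01.
have e2 : 2 ^+ (8 * a) <= expR (8 * a%:R) :> R.
  have -> : 8 * a%:R = (8 * a)%:R * 1 :> R by rewrite mulr1 natrM.
  rewrite expRM_natl; apply: lerXn2r; rewrite ?nnegrE ?expR_ge0//.
  by have := expR_ge1Dx (1 : R); apply: le_trans; lra.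
apply: (@le_trans _ _ (expR (8 * a%:R) * expR (- (2^-1 * q / 2 * S)))).
  by rewrite ler_wpM2r ?expR_ge0.
rewrite -expRD.
have a0 : 0 < a%:R :> R by rewrite ltr0n.
have la0 : 0 < lam * a%:R by rewrite mulr_gt0.
apply: (@le_trans _ _ (expR (- (lam * a%:R)))).
  rewrite ler_expR.
  have h1 : (lam + 8) * a%:R <= q * m / 4 * a%:R by rewrite ler_wpM2r// ltW.
  have h2 : q * (m * a%:R) <= q * S by rewrite ler_wpM2l// ltW.
  by nra.
rewrite expRN lef_pV2 ?posrE ?expR_gt0//.
by apply: le_trans (expR_ge1Dx _); rewrite lerDr ler01.
Qed.

(** A union bound over the letter pairs of the first row shows that the failure
probability f a for sets of size a satisfies f a <= 4 (1/(lam a) + f (8a)).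
The bound 8/(lam a) reproduces itself, since f (8a) <= 1/(lam a). *)
Lemma thrives_fail j y n A : (0 < size A)%N -> (8 ^ n * size A <= L)%N ->
  seeds j y n A -> (j.+1 * B <= X)%N -> (y + n < Y)%N ->
  E (fun s => (~~ thrives j s y A n)%:R) <= 8 / (lam * (size A)%:R).
Proof.
elim: n y A => [|n IHn] y A A0 AL hA jX yY.
  under [X in bexp _ _ X]eq_fun do rewrite /=.
  by rewrite bexp_cst divr_ge0// mulr_ge0// ltW.
have a0 : 0 < (size A)%:R :> R by rewrite ltr0n.
set a : R := (size A)%:R in a0 *.
(* P is success in the first row, Q success afterwards; Q reads the first row
   from s and the later rows from s'. *)
pose P ab s := size (nxt j s y ab A) == (8 * size A)%N.
pose Q ab s s' := thrives j s' y.+1 (nxt j s y ab A) n.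
have split_le s : (~~ thrives j s y A n.+1)%:R <=
   \sum_(ab : bool * bool) ((~~ P ab s)%:R + (P ab s && ~~ Q ab s s)%:R) :> R.
  case: (boolP (thrives _ _ _ _ _)) => [_|]; first by apply: sumr_ge0 => ab _; rewrite addr_ge0.
  move=> /forallPn[ab PQ]; rewrite (bigD1 ab)//= -[leLHS]addr0 lerD//; last first.
    by apply: sumr_ge0 => ab' _; rewrite addr_ge0.
  move: PQ; rewrite -/(P ab s) -/(Q ab s s) negb_and.
  by case: (P ab s) => /= [->|_]; rewrite ?addr0 ?add0r.
apply: le_trans (ler_bexp (weight01 p01 eps01 p_01) _ _ split_le) _.
rewrite bexp_sum.
have step ab : E (fun s => (~~ P ab s)%:R + (P ab s && ~~ Q ab s s)%:R) <=
    2 / (lam * a).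
  rewrite bexpD; have -> : 2 / (lam * a) = (lam * a)^-1 + (lam * a)^-1 by field; rewrite !gt_eqF.
  apply: lerD.
    apply: (nxt_small ab A0 _ hA) => //; last by lia.
    by apply: leq_trans AL; rewrite leq_pmull// expn_gt0.
  apply: (@bexp_cond _ _ _ (weight01 p01 eps01 p_01) (fun c => row c == y) (fun c => (y < row c)%N)
    _ (fun s s' => (P ab s && ~~ Q ab s s')%:R)).
  - by move=> c /eqP ->; rewrite ltnn.
  - move=> s' s t st; congr (nat_of_bool _)%:R; rewrite /P /Q (@nxt_eq _ _ _ j s t)//.
      exact: seeds_cols hA.
    by move=> c _ cy; apply: st; rewrite cy.
  - move=> s s' t st; congr (nat_of_bool (_ && ~~ _))%:R; apply: thrives_eq; first exact: nxt_cols.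
    by move=> c _ cy; apply: st; case/andP: cy.
  move=> s; case: (boolP (P ab s)) => /= Ps; last by rewrite bexp_cst invr_ge0 mulr_ge0// ltW.
  apply: le_trans (IHn y.+1 (nxt j s y ab A) _ _ _ _ _) _ => //.
  - by rewrite (eqP Ps) muln_gt0.
  - by rewrite (eqP Ps); apply: leq_trans AL; rewrite expnS; lia.
  - exact: nxt_seeds.
  - by lia.
  - rewrite (eqP Ps) natrM -/a le_eqVlt; apply/orP; left; apply/eqP.
    by field; rewrite !gt_eqF.
apply: le_trans (ler_sum _ (fun ab _ => step ab)) _.
rewrite sumr_const card_prod card_bool /= le_eqVlt; apply/orP; left; apply/eqP.
by rewrite -mulr_natl; field; rewrite !gt_eqF.
Qed.

End GrowthProbability.

(** * Blocks and the jumps between them *)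

Section Blocks.
Variables (H M V : nat).
Hypothesis V0 : (0 < V)%N.
Hypothesis HMV : (H * M <= 2 * V)%N.

Local Notation L := (8 ^ H)%N.
Local Notation B := (4 * V)%N.
Local Notation h := H.+1.

(** The possible starting columns of block j in row y.  They lie in the left half of
the block and have the parity of y. *)
Definition core (j y : nat) : seq nat :=
  [seq (j * B + (i.*2 + odd y))%N | i <- iota 0 V].

Definition good (j : nat) (s : config) (y x : nat) : bool :=
  thrives L M B j s y [:: x] H.

Definition anywhere (u z : nat) : bool := true.

Definition lands (j : nat) (s : config) (y : nat) (ab : bool * bool) (A : seq nat) : bool :=
  has (fun z => good j s y.+1 z && hit s y anywhere ab A z) (core j y.+1).

(** Site (k, t) of the coarse lattice stands for block k + 2t at level t.  The oriented
steps from (k, t) to (k, t+1) and (k+1, t+1) are then jumps to the second and the third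
block on the right, which are at least as long as a block. *)
Definition home (kt : nat * nat) : nat := (kt.1 + 2 * kt.2)%N.

Definition start (kt : nat * nat) : nat := (kt.2 * h)%N.

(** The obstructions to percolation: at a site that is not bad, each good starting
column passes every word on to good starting columns of both target blocks. *)
Definition bad (s : config) (kt : nat * nat) : bool :=
  has (fun x => good (home kt) s (start kt) x &&
     ~~ [forall w : H.-tuple (bool * bool), [forall ab : bool * bool, [forall d : bool,
         lands (home kt + (2 + d)) s (start kt + H) ab
           (grow L M B (home kt) s (start kt) [:: x] w)]]])
    (core (home kt) (start kt)).

Lemma L_gt0 : (0 < L)%N. Proof. by rewrite expn_gt0. Qed.

Lemma core_uniq j y : uniq (core j y).
Proof. by rewrite map_inj_uniq ?iota_uniq// => a b; clear; lia. Qed.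

Lemma size_core j y : size (core j y) = V.
Proof. by rewrite size_map size_iota. Qed.

Lemma coreP j y x : x \in core j y ->
  [/\ (j * B <= x)%N, (x < j * B + 2 * V)%N & ~~ odd (x + y)].
Proof.
move=> /mapP[i]; rewrite mem_iota add0n /= => iV ->; split.
- by rewrite leq_addr.
- by rewrite ltn_add2l; case: (odd y); clear - iV; lia.
- by rewrite !oddD odd_double !oddM /= andbF oddb; case: odd.
Qed.

Lemma core_seeds j y x : x \in core j y -> seeds M B j y H [:: x].
Proof.
move=> /coreP[jx xj oxy]; split => // u; rewrite inE => /eqP ->; split => //.
by rewrite mulSn; clear - xj HMV V0; lia.
Qed.

Lemma core_cols j y x : x \in core j y -> x \in cols B j.
Proof. by move=> /core_seeds hs; apply: (seeds_cols hs); rewrite inE. Qed.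

Lemma good_eq j (s s' : config) y x : x \in cols B j ->
  (forall c, (column c %/ B)%N = j -> (y <= row c < y + H)%N -> s c = s' c) ->
  good j s y x = good j s' y x.
Proof.
by move=> xj ss'; apply: thrives_eq => // u; rewrite inE => /eqP ->.
Qed.

(** The pairs (block, level) whose bits decide whether a site is bad: its own block,
the two target blocks in the row of the jump, and the two target blocks at the
next level, where goodness of the landing columns is decided. *)
Definition cells (kt : nat * nat) (c : coord) : bool :=
  ((row c %/ h == kt.2)%N &&
    ((column c %/ B)%N \in [:: home kt; (home kt + 2)%N; (home kt + 3)%N])) ||
  ((row c %/ h == kt.2.+1)%N &&
    ((column c %/ B)%N \in [:: (home kt + 2)%N; (home kt + 3)%N])).

Lemma divn_h t r i : (i < h)%N -> r = (t * h + i)%N -> (r %/ h)%N = t.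
Proof. by move=> ih ->; rewrite divnMDl// divn_small ?addn0. Qed.

Lemma bad_dep kt : depends_on (cells kt) (fun s => bad s kt).
Proof.
case: kt => k t s s' ss'; apply: eq_in_has => x xc; rewrite /start /= in xc *.
set j := home (k, t) in xc *.
have xj := core_cols xc.
have lev0 c : (t * h <= row c < t * h + H.+1)%N -> (row c %/ h)%N = t.
  by move=> /andP[c1 c2]; apply: (@divn_h t _ (row c - t * h)); lia.
have lev1 c : (t.+1 * h <= row c < t.+1 * h + H.+1)%N -> (row c %/ h)%N = t.+1.
  by move=> /andP[c1 c2]; apply: (@divn_h t.+1 _ (row c - t.+1 * h)); lia.
congr (_ && ~~ _).
  apply: good_eq => // c cj cy; apply: ss'; rewrite /cells lev0 ?eqxx; last by lia.
  by rewrite cj mem_head.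
apply: eq_forallb => w; apply: eq_forallb => ab; apply: eq_forallb => d.
have -> : grow L M B j s (t * h) [:: x] w = grow L M B j s' (t * h) [:: x] w.
  apply: grow_eq; first by move=> u; rewrite inE => /eqP ->.
  rewrite size_tuple => c cj cy; apply: ss'; rewrite /cells lev0 ?eqxx; last by lia.
  by rewrite cj mem_head.
set A := grow _ _ _ _ _ _ _ _.
have Aj : {subset A <= cols B j}.
  by apply: grow_cols => u; rewrite inE => /eqP ->.
have dj : (j + (2 + d))%N \in [:: (j + 2)%N; (j + 3)%N].
  by case: d; rewrite !inE eqxx ?orbT.
apply: eq_in_has => z zc.
have zj := core_cols zc.
have yJ : (t * h + H).+1 = (t.+1 * h)%N by rewrite mulSn; lia.
congr (_ && _).
  apply: good_eq => // c cj; rewrite yJ => cy; apply: ss'; rewrite /cells lev1 ?eqxx; last by lia.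
  by rewrite cj dj orbT.
apply: hit_eq => c cz cy; apply: ss'; rewrite /cells lev0 ?eqxx; try by rewrite cy; lia.
  by rewrite cz (cols_div zj) inE dj orbT.
by rewrite (cols_div (Aj _ cz)) mem_head.
Qed.

(** The blocks used at one level are at distance at most 3, and only two successive
levels are used: hence eight classes of independent sites. *)
Lemma cells_disjoint kt kt' c : kt != kt' ->
  (kt.1 = kt'.1 %[mod 4])%N -> (kt.2 = kt'.2 %[mod 2])%N ->
  cells kt c -> ~~ cells kt' c.
Proof.
case: kt kt' => [k t] [k' t'] /= ne e4 e2; rewrite /cells /home /= !inE.
move: (row c %/ h)%N (column c %/ B)%N => r b.
have {ne} : (k != k') || (t != t').
  by rewrite -negb_and; apply: contra ne => /andP[/eqP -> /eqP ->].
clear - e4 e2 => ne H1; apply/negP => H2.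
lia.
Qed.

End Blocks.

Section BlockProbability.
Variables (R : realType) (p eps : R) (p_ : nat -> R).
Hypothesis p01 : 0 < p < 1.
Hypothesis eps01 : 0 < eps <= 1.
Hypothesis p_01 : forall i, (0 < i)%N -> 0 <= p_ i <= 1.

Local Notation q := (mark_rate p eps).

Variables (H M V : nat).
Hypothesis V0 : (0 < V)%N.
Hypothesis HMV : (H * M <= 2 * V)%N.

Local Notation L := (8 ^ H)%N.
Local Notation B := (4 * V)%N.
Local Notation h := H.+1.
Local Notation core := (core V).
Local Notation good := (good H M V).
Local Notation lands := (lands H M V).
Local Notation start := (start H).
Local Notation bad := (bad H M V).

Variables (lam rJ : R) (X Y : nat).
Hypothesis lam0 : 0 < lam.
Hypothesis rate_p : forall i, (L <= i < M)%N -> rate R i <= p_ i.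
Variable m : R.
Hypothesis lam_m : lam + 8 <= q * m / 4.
Hypothesis mass : m <= \sum_(0 <= i < M | odd i && (L <= i)%N) rate R i.
Hypothesis rJ0 : 0 <= rJ.
Hypothesis rJ_p : forall i, (B <= i <= 4 * B)%N -> rJ <= p_ i.
Hypothesis rJ_L : L%:R * rJ <= 1.
Hypothesis rJ_jump :
  (V * 4 ^ H * 8)%:R * expR (- (q / 4 * (V%:R * (L%:R * rJ)))) <= lam^-1.

Local Notation E f := (bexp (weight p eps p_) (box X Y) f (fun=> false)).

Lemma good_fail j y x : x \in core j y -> (j.+1 * B <= X)%N -> (y + H < Y)%N ->
  E (fun s => (~~ good j s y x)%:R) <= 8 / lam.
Proof.
move=> xc jX yY; have := @thrives_fail R p eps p_ p01 eps01 p_01 L M B (L_gt0 H) rate_p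
  m lam lam0 lam_m mass X Y j y H [:: x].
by rewrite /= muln1 mulr1; apply => //; exact: core_seeds.
Qed.

Definition sparse (j : nat) (s : config) (y : nat) : bool :=
  (2 * count (good j s y) (core j y) < V)%N.

(** Markov's inequality: the expected proportion of columns that are not good is
at most 8/lam. *)
Lemma sparse_le j y : (j.+1 * B <= X)%N -> (y + H < Y)%N ->
  E (fun s => (sparse j s y)%:R) <= 16 / lam.
Proof.
move=> jX yY; have VR : 0 < V%:R :> R by rewrite ltr0n.
have le1 s : (sparse j s y)%:R <= 2 / V%:R * \sum_(z <- core j y) (~~ good j s y z)%:R :> R.
  have -> : \sum_(z <- core j y) (~~ good j s y z)%:R =
     (count (predC (good j s y)) (core j y))%:R :> R.
    by rewrite -sum1_count natr_sum [RHS]big_mkcond /=; apply: eq_bigr => z _; case: good.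
  case: (boolP (sparse j s y)) => [sp|_]; last by rewrite mulr_ge0// divr_ge0.
  rewrite mulrAC ler_pdivlMr// mul1r -natrM ler_nat.
  by have := count_predC (good j s y) (core j y); rewrite size_core; move: sp; rewrite /sparse; clear; lia.
apply: le_trans (ler_bexp (weight01 p01 eps01 p_01) _ _ le1) _.
rewrite bexpZ bexp_sum big_seq.
apply: (@le_trans _ _ (2 / V%:R * \sum_(z <- core j y | z \in core j y) (8 / lam))).
  rewrite ler_wpM2l ?divr_ge0//; apply: ler_sum => z zc; exact: good_fail.
rewrite -big_seq big_const_seq count_predT size_core iter_addr addr0 -[_ *+ V]mulr_natl.
by rewrite le_eqVlt; apply/orP; left; apply/eqP; field; rewrite !gt_eqF.
Qed.

Lemma prod_miss (T : Type) (P : T -> bool) (zs : seq T) :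
  (~~ has P zs)%:R = \prod_(z <- zs) (1 - 1 * (P z)%:R) :> R.
Proof.
elim: zs => [|z zs IHz] /=; first by rewrite big_nil.
by rewrite big_cons -IHz mul1r; case: (P z); rewrite /= ?subrr ?mul0r ?subr0 ?mul1r.
Qed.

Lemma jump_distance j (d : bool) u z : (j * B <= u < j.+1 * B)%N ->
  z \in cols B (j + (2 + d)) -> (u < z)%N && (B <= z - u <= 4 * B)%N.
Proof.
rewrite mem_cols !mulSn !mulnDl; clear - V0.
by set a := (j * B)%N; set b := B; case: d => /=; lia.
Qed.

(** Growth and goodness of the landing columns are decided outside the row of the jump.
Given them, at least V L / 2 pairs of columns are available in that row, each
joined with probability at least rJ. *)
Lemma jump_fail kt (d : bool) x (w : H.-tuple (bool * bool)) ab :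
  let j := home kt in let y := start kt in let j' := (j + (2 + d))%N in
  x \in core j y -> (j'.+1 * B <= X)%N -> ((y + H).+1 + H < Y)%N ->
  E (fun s => [&& ~~ sparse j' s (y + H).+1, good j s y x &
     ~~ lands j' s (y + H) ab (grow L M B j s y [:: x] w)]%:R) <=
  expR (- (q / 4 * (V%:R * (L%:R * rJ)))).
Proof.
move=> j y j' xc jX yY.
have xj := core_cols V0 HMV xc.
have x1j : {subset [:: x] <= cols B j} by move=> u; rewrite inE => /eqP ->.
(* A and G are read from the past s, the jump from s'. *)
pose A s := grow L M B j s y [:: x] w.
pose G s := [seq z <- core j' (y + H).+1 | good j' s (y + H).+1 z].
have landsE s : lands j' s (y + H) ab (A s) = has (hit s (y + H) anywhere ab (A s)) (G s).
  rewrite /lands /G !has_filter -filter_predI; congr (_ != _).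
  by apply: eq_filter => z /=; rewrite andbC.
under [X in bexp _ _ X]eq_fun do rewrite landsE.
apply: (@bexp_cond _ _ _ (weight01 p01 eps01 p_01) (fun c => row c != y + H)%N
    (fun c => row c == y + H)%N _
    (fun s s' => [&& ~~ sparse j' s (y + H).+1, good j s y x &
      ~~ has (hit s' (y + H) anywhere ab (A s)) (G s)]%:R)).
- by [].
- move=> s' s t st.
  have gE z : z \in core j' (y + H).+1 -> good j' s (y + H).+1 z = good j' t (y + H).+1 z.
    move=> /(core_cols V0 HMV) zj; apply: good_eq => // c _ cy; apply: st.
    by case/andP: cy => cy _; rewrite gtn_eqF.
  have -> : A s = A t.
    apply: grow_eq => // c _; rewrite size_tuple => /andP[_ cy]; apply: st.
    by rewrite ltn_eqF.
  have -> : G s = G t by exact: eq_in_filter.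
  have -> : sparse j' s (y + H).+1 = sparse j' t (y + H).+1.
    by rewrite /sparse (eq_in_count gE).
  have -> // : good j s y x = good j t y x.
  by apply: good_eq => // c _ /andP[_ cy]; apply: st; rewrite ltn_eqF.
- move=> s s' t st; congr (nat_of_bool [&& _, _ & ~~ _])%:R.
  by apply: eq_has => z; apply: hit_eq => c _ cy; apply: st; rewrite cy.
move=> s; case: (boolP (sparse _ _ _)) => [_|] /=; first by rewrite bexp_cst expR_ge0.
rewrite -leqNgt => spE.
case: (boolP (good j s y x)) => [gx|_] /=; last by rewrite bexp_cst expR_ge0.
under [X in bexp _ _ X]eq_fun do rewrite prod_miss.
have sA : size (A s) = L.
  by rewrite /A size_grow ?size_tuple ?muln1//.
have hA : seeds M B j (y + H) 0 (A s).
  have := @grow_seeds L M B j s y 0 [:: x] w; rewrite size_tuple addn0; apply.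
  exact: core_seeds.
have GP z : z \in G s -> z \in core j' (y + H).+1 by rewrite mem_filter => /andP[].
have GX z : z \in G s -> (z < X)%N.
  move=> /GP/(core_cols V0 HMV); rewrite mem_cols => /andP[_ zj].
  exact: leq_trans zj jX.
have q0 := mark_rate_gt0 p01 eps01.
have AG u z : u \in A s -> z \in G s -> (u < z)%N && (B <= z - u <= 4 * B)%N.
  move=> uA /GP/(core_cols V0 HMV) zj; apply: (@jump_distance j d) => //.
  by have := seeds_cols hA uA; rewrite mem_cols.
apply: (@le_trans _ _ (expR (- (1 * q / 2 *
    \sum_(z <- G s) \sum_(u <- A s | anywhere u z) rJ)))).
  apply: (@bexp_hits _ _ _ _ p01 eps01 p_01 _ (box_uniq X Y) _ _ _ _ _ (fun _ _ => rJ)) => //.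
  - by rewrite ler01 lexx.
  - by case: hA.
  - by rewrite filter_uniq// core_uniq.
  - move=> z zG; have zX := GX z zG; have [_ _ oz] := coreP (GP z zG).
    move: oz; rewrite addnS /= negbK !mem_box zX /= => ->.
    by clear - yY; split => //; lia.
  - move=> u z uA zG _; have /andP[uz zu] := AG u z uA zG; split => //.
      by rewrite mem_box uz (GX z zG) /=; clear - yY; lia.
    by rewrite rJ0 rJ_p.
  - move=> z _; rewrite /anywhere big_const_seq count_predT sA iter_addr addr0.
    by rewrite -[leLHS]mulr_natl.
rewrite ler_expR lerN2 /anywhere.
rewrite [X in 1 * q / 2 * X](_ : _ = (size (G s))%:R * (L%:R * rJ)); last first.
  have inner : \sum_(u <- A s) rJ = L%:R * rJ.
    by rewrite big_const_seq count_predT iter_addr addr0 sA -[LHS]mulr_natl.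
  rewrite (eq_bigr (fun=> L%:R * rJ)); last by move=> z _; exact: inner.
  by rewrite big_const_seq count_predT iter_addr addr0 -[LHS]mulr_natl.
have VG : V%:R <= 2 * (size (G s))%:R :> R.
  by rewrite -natrM ler_nat size_filter.
have LrJ : 0 <= L%:R * rJ by rewrite mulr_ge0.
have h1 : V%:R * (L%:R * rJ) <= 2 * (size (G s))%:R * (L%:R * rJ) by rewrite ler_wpM2r.
have h2 : q / 4 * (V%:R * (L%:R * rJ)) <= q / 4 * (2 * (size (G s))%:R * (L%:R * rJ)).
  by rewrite ler_wpM2l// divr_ge0// ltW.
by apply: le_trans h2 _; rewrite le_eqVlt; apply/orP; left; apply/eqP; field.
Qed.

(** The two target blocks are sparse with probability at most 32/lam in total, and a
union bound over the V * 4^H * 8 possible jumps contributes 1/lam. *)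
Lemma bad_le kt : ((home kt + 4) * B <= X)%N -> (start kt + 2 * h <= Y)%N ->
  E (fun s => (bad s kt)%:R) <= 33 / lam.
Proof.
move=> jX yY; set j := home kt in jX *; set y := start kt in yY *.
pose F d x (w : H.-tuple (bool * bool)) ab s :=
  [&& ~~ sparse (j + (2 + nat_of_bool d)) s (y + H).+1, good j s y x &
     ~~ lands (j + (2 + nat_of_bool d)) s (y + H) ab (grow L M B j s y [:: x] w)].
have le1 s : (bad s kt)%:R <=
   \sum_(d : bool) (sparse (j + (2 + d)) s (y + H).+1)%:R +
   \sum_(d : bool) \sum_(x <- core j y) \sum_w \sum_ab (F d x w ab s)%:R :> R.
  have S1 : 0 <= \sum_(d : bool) (sparse (j + (2 + d)) s (y + H).+1)%:R :> R.
    by apply: sumr_ge0.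
  have S2 : 0 <= \sum_(d : bool) \sum_(x <- core j y) \sum_w \sum_ab (F d x w ab s)%:R :> R.
    by do 4! (apply: sumr_ge0 => ? _).
  case: (boolP (bad s kt)) => [/hasP[x xc /andP[gx]]|_]; last by rewrite addr_ge0.
  move=> /forallPn[w /forallPn[ab /forallPn[d nl]]].
  case: (boolP (sparse (j + (2 + d)) s (y + H).+1)) => [sp|nsp].
    rewrite -[leLHS]addr0 lerD// (bigD1 d)//= sp -[leLHS]addr0 lerD//.
    exact: sumr_ge0.
  rewrite -[leLHS]add0r lerD//.
  have Fx : F d x w ab s by rewrite /F nsp gx.
  rewrite (bigD1 d)//= (bigD1_seq x xc (core_uniq _ _ _))//= (bigD1 w)//= (bigD1 ab)//= Fx.
  rewrite -!addrA lerDl !addr_ge0// ?sumr_ge0//; do ?[move=> ? _; apply: sumr_ge0 => ? _];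
   do ?[apply: sumr_ge0 => ? _] => //.
apply: le_trans (ler_bexp (weight01 p01 eps01 p_01) _ _ le1) _.
have jX' (d : bool) : ((j + (2 + d)).+1 * B <= X)%N.
  by apply: leq_trans jX; rewrite leq_mul2r; case: d; clear; lia.
have yE : ((y + H).+1 + H < Y)%N by clear - yY; lia.
rewrite bexpD (_ : 33 / lam = 32 / lam + lam^-1); last by field; rewrite gt_eqF.
apply: lerD.
  rewrite bexp_sum; apply: (@le_trans _ _ (\sum_(d : bool) 16 / lam)).
    by apply: ler_sum => d _; apply: sparse_le.
  rewrite sumr_const card_bool -[_ *+ 2]mulr_natl.
  by rewrite le_eqVlt; apply/orP; left; apply/eqP; field; rewrite gt_eqF.
apply: le_trans rJ_jump; set e := expR _.
rewrite bexp_sum; apply: (@le_trans _ _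
    (\sum_(d : bool) \sum_(x <- core j y) \sum_(w : H.-tuple (bool * bool)) \sum_(ab : bool * bool) e)).
  apply: ler_sum => d _; rewrite bexp_sum [leLHS]big_seq [leRHS]big_seq; apply: ler_sum => x xc.
  rewrite bexp_sum; apply: ler_sum => w _; rewrite bexp_sum; apply: ler_sum => ab _.
  exact: jump_fail.
have sumT (T : finType) (a : R) : \sum_(i : T) a = #|T|%:R * a.
  by rewrite sumr_const mulr_natl.
have sum_core (a : R) : \sum_(i <- core j y) a = V%:R * a.
  by rewrite big_const_seq count_predT size_core iter_addr addr0 mulr_natl.
rewrite sumT sum_core !sumT card_tuple card_prod card_bool !mulrA -!natrM.
rewrite le_eqVlt; apply/orP; left; apply/eqP; congr (_%:R * _).
by rewrite (_ : (2 * 2)%N = 4%N)//; set c := (4 ^ H)%N; clear; lia.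
Qed.

End BlockProbability.

(** * A contour estimate for oriented percolation *)

(** A site kt is called dead below when this fails for the number n of levels that
remain above it. *)
Fixpoint survives (b : nat * nat -> bool) (n : nat) (kt : nat * nat) : bool :=
  if n is n'.+1 then
    ~~ b kt && (survives b n' (kt.1, kt.2.+1) || survives b n' (kt.1.+1, kt.2.+1))
  else true.

(** A contour goes up along the left side of dead sites, down along their right
side, and to the right under a site where b holds.  Site (k, t) has its lower
corners at (k, t) and (k+1, t), and the two sites above it span the corners (k, t+1) and
(k+2, t+1). *)
Definition wall_step (b : nat * nat -> bool) (x y : nat * nat) : bool :=
  [|| y == (x.1, x.2.+1), x == (y.1.+1, y.2.+1) | (y == (x.1.+1, x.2)) && b x].

(** A contour from the left to the right corner of a dead site: either the site
satisfies b, or both sites above it are dead and their contours are joined,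
after a step up and before a step down. *)
Lemma wall b n k t : ~~ survives b n (k, t) ->
  exists q, [/\ path (wall_step b) (k, t) q, last (k, t) q = (k.+1, t) &
    (size q <= 4 ^ n)%N].
Proof.
elim: n k t => [|n IHn] k t //=; case: (boolP (b (k, t))) => [bkt _|_ /=].
  exists [:: (k.+1, t)]; split => //=; last by rewrite expn_gt0.
  by rewrite /wall_step bkt eqxx !orbT.
rewrite negb_or => /andP[/IHn[q1 [p1 l1 s1]] /IHn[q2 [p2 l2 s2]]].
exists ((k, t.+1) :: q1 ++ rcons q2 (k.+1, t)); split.
- rewrite /= cat_path rcons_path p1 l1 p2 l2 /= /wall_step /= !eqxx /=.
  by rewrite orbT.
- by rewrite /= last_cat last_rcons.
- rewrite /= size_cat size_rcons expnS.
  have : (0 < 4 ^ n)%N by rewrite expn_gt0.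
  by move: s1 s2; set c := (4 ^ n)%N; clear; lia.
Qed.

(** Three letters code the steps of a contour: Some true goes up, Some false goes
down, None goes to the right. *)
Definition move (d : option bool) (x : nat * nat) : nat * nat :=
  match d with
  | Some true => (x.1, x.2.+1)
  | Some false => (x.1.-1, x.2.-1)
  | None => (x.1.+1, x.2)
  end.

(** The sites where b has to hold for the coded walk to be a contour. *)
Fixpoint bricks (c : seq (option bool)) (x : nat * nat) : seq (nat * nat) :=
  if c is d :: c' then
    if d is None then x :: bricks c' (move d x) else bricks c' (move d x)
  else [::].

(** Counting displacements in each direction relates the numbers of steps of the
three kinds. *)
Lemma wall_code b x q : path (wall_step b) x q -> uniq (x :: q) ->
  exists c, [/\ size c = size q, uniq (bricks c x), all b (bricks c x),
     {subset bricks c x <= x :: q} &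
     exists u d, [/\ ((last x q).1 + d = x.1 + size (bricks c x))%N,
       ((last x q).2 + d = x.2 + u)%N & (size c = size (bricks c x) + d + u)%N]].
Proof.
elim: q x => [|y q IHq] x /=.
  by move=> _ _; exists [::]; split => //; exists 0%N, 0%N; rewrite !addn0.
move=> /andP[xy yq] /andP[xq uq].
have [c [sc uc bc cq [u [d [e1 e2 e3]]]]] := IHq y yq uq.
have sub : {subset bricks c y <= x :: y :: q} by move=> z /cq; rewrite [in X in _ -> X]inE => ->; rewrite orbT.
case/or3P: xy => [/eqP yx|/eqP xy|/andP[/eqP yx bx]].
- exists (Some true :: c); rewrite /= -yx; split => //=; first by rewrite sc.
  by exists u.+1, d; rewrite yx /= in e1 e2 e3 *; split; lia.
- have yx : y = (x.1.-1, x.2.-1) by rewrite xy /=; case: (y).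
  exists (Some false :: c); rewrite /= -yx; split => //=; first by rewrite sc.
  by exists u, d.+1; rewrite xy /=; split; lia.
- exists (None :: c); rewrite /= -yx bx; split => //=; first by rewrite sc.
  + by rewrite uc andbT; apply: contra xq => /cq.
  + by move=> z; rewrite inE => /predU1P[->|/sub//]; rewrite mem_head.
  + by exists u, d; rewrite yx /= in e1 e2 e3 *; split; lia.
Qed.

(** Loop erasure makes the sites on the contour distinct.  Since the total
displacement is (1, 0), there are as many steps up as down, and one more step to the
right. *)
Lemma wall_bricks b n k t : ~~ survives b n (k, t) ->
  exists c, [/\ (size c <= 4 ^ n)%N, uniq (bricks c (k, t)), all b (bricks c (k, t)) &
    (3 * size (bricks c (k, t)) == (size c).+2)%N].
Proof.
move=> /wall[q [pq lq sq]].
move: lq; case/shortenP: pq => q' pq' uq' q'q lq'.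
have [c [sc uc bc _ [u [d [e1 e2 e3]]]]] := wall_code pq' uq'.
exists c; split => //.
  rewrite sc; apply: leq_trans sq; move: uq' => /= /andP[_ uq'].
  exact: uniq_leq_size.
by rewrite lq' /= in e1 e2; lia.
Qed.

Lemma popular_class (T : Type) (C : finType) (cl : T -> C) (r : seq T) :
  (0 < #|C|)%N -> exists i, (size r <= #|C| * count (fun x => cl x == i) r)%N.
Proof.
move=> C0; have total : (\sum_(i : C) count (fun x => cl x == i) r = size r)%N.
  elim: r => [|x r IHr] /=; first by rewrite big1.
  rewrite big_split /= IHr (bigD1 (cl x))//= eqxx big1 ?addn0// => i.
  by rewrite eq_sym => /negPf ->.
apply: contrapT => /forallNP small.
have : (\sum_(i : C) (#|C| * count (fun x => cl x == i) r).+1 <= \sum_(i : C) size r)%N.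
  by apply: leq_sum => i _; rewrite ltnNge; apply/negP; exact: small.
rewrite sum_nat_const -[X in (_ <= #|C| * X)%N]total big_distrr /=.
under eq_bigr do rewrite -addn1.
by rewrite big_split /= sum_nat_const muln1 -[X in (_ <= X)%N]addn0 leq_add2l leqNgt C0.
Qed.

Section Peierls.
Variables (R : realType) (I : eqType) (w : I -> R) (l : seq I) (s0 : I -> bool).
Hypothesis w01 : forall i, 0 <= w i <= 1.
Variables (bd : (I -> bool) -> nat * nat -> bool) (D : nat * nat -> I -> bool).
Variables (C : finType) (cl : nat * nat -> C) (theta : R).
Hypothesis bd_dep : forall x, depends_on (D x) (fun s => bd s x).
Hypothesis cl_disjoint : forall x y i, x != y -> cl x = cl y -> D x i -> ~~ D y i.
Hypothesis theta0 : 0 < theta <= 6^-1.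
Hypothesis C0 : (0 < #|C|)%N.
Hypothesis bd_rare : forall x, bexp w l (fun s => (bd s x)%:R) s0 <= theta ^+ (3 * #|C|).

(** Keep only the sites of the most frequent class, which are independent. *)
Lemma bricks_rare (r : seq (nat * nat)) : uniq r ->
  bexp w l (fun s => (all (bd s) r)%:R) s0 <= theta ^+ (3 * size r).
Proof.
move=> ur; have [i ri] := popular_class cl r C0; have /andP[t0 t1] := theta0.
(* The exponents match: 3 * #|C| per site for the sites of r' gives 3 per site
   of r. *)
pose r' := [seq x <- r | cl x == i].
have le1 s : (all (bd s) r)%:R <= \prod_(x <- r') (bd s x)%:R :> R.
  case: (boolP (all _ _)) => [/allP br|_]; last by apply: prodr_ge0.
  rewrite big_seq big1// => x; rewrite mem_filter => /andP[_ xr].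
  by rewrite br.
apply: le_trans (ler_bexp w01 _ _ le1) _.
rewrite (@bexp_prod _ _ _ _ _ D); first last.
- move=> x y j; rewrite !mem_filter => /andP[/eqP xi _] /andP[/eqP yi _] xy.
  by apply: cl_disjoint => //; rewrite xi yi.
- by move=> x _ s s' ss'; rewrite (bd_dep ss').
- exact: filter_uniq.
apply: (@le_trans _ _ (\prod_(x <- r') theta ^+ (3 * #|C|))).
  by apply: ler_prod => x _; rewrite bd_rare bexp_ge0.
rewrite big_const_seq count_predT -Monoid.iteropE /= -[iterop _ _ _ _]/(_ ^+ _) -exprM.
rewrite size_filter ler_wiXn2l ?(ltW t0)//; last by rewrite -mulnA leq_mul2l ri.
by apply: le_trans t1 _; rewrite invf_le1 ?ler1n.
Qed.

(** There are 3^l codes of length l, and the (l+2)/3 distinct sites of such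
a contour satisfy bd with probability at most theta^(l+2). *)
Theorem peierls n x : bexp w l (fun s => (~~ survives (bd s) n x)%:R) s0 <= 18^-1.
Proof.
pose ok (c : seq (option bool)) := uniq (bricks c x) && (3 * size (bricks c x) == (size c).+2)%N.
have le1 s : (~~ survives (bd s) n x)%:R <=
    \sum_(L < (4 ^ n).+1) \sum_(c : L.-tuple (option bool) | ok c) (all (bd s) (bricks c x))%:R :> R.
  case: (boolP (survives _ _ _)) => [_|] /=.
    by apply: sumr_ge0 => L _; apply: sumr_ge0.
  rewrite {1}(surjective_pairing x) => /wall_bricks; rewrite -surjective_pairing => -[c [sc uc bc nc]].
  have sc' : (size c < (4 ^ n).+1)%N by [].
  rewrite (bigD1 (Ordinal sc'))//= (bigD1 (in_tuple c)) /=; last by rewrite /ok uc.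
  by rewrite bc -addrA lerDl addr_ge0// ?sumr_ge0// => L _; apply: sumr_ge0.
apply: le_trans (ler_bexp w01 _ _ le1) _.
have /andP[t0 t1] := theta0.
rewrite bexp_sum; apply: (@le_trans _ _ (\sum_(L < (4 ^ n).+1) 36^-1 * 2^-1 ^+ L)).
  apply: ler_sum => L _; rewrite bexp_sum.
  apply: (@le_trans _ _ (\sum_(c : L.-tuple (option bool)) 6^-1 ^+ L.+2)).
    rewrite big_mkcond /=; apply: ler_sum => c _; case: ifP => [/andP[uc /eqP nc]|_].
      apply: le_trans (bricks_rare uc) _; rewrite nc size_tuple.
      by rewrite lerXn2r// nnegrE ltW// (lt_le_trans t0).
    by rewrite exprn_ge0.
  rewrite sumr_const card_tuple card_option card_bool -[_ *+ _]mulr_natl natrX.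
  rewrite !exprS mulrCA [X in _ * X]mulrCA mulrA -exprMn le_eqVlt; apply/orP; left; apply/eqP.
  by congr (_ * _ ^+ _); field.
rewrite -mulr_sumr.
have geo k : \sum_(L < k) 2^-1 ^+ L <= 2 - 2 * 2^-1 ^+ k :> R.
  elim: k => [|k IHk]; first by rewrite big_ord0 expr0; lra.
  by rewrite big_ord_recr exprS /=; lra.
apply: le_trans (ler_wpM2l _ (geo _)) _; first by rewrite invr_ge0.
have : 0 <= 2^-1 ^+ (4 ^ n).+1 :> R by rewrite exprn_ge0// invr_ge0.
by move=> ?; lra.
Qed.

End Peierls.

(** * Following a word from block to block, and probabilities of cylinders *)

Section Routes.
Variables (H M V : nat).
Hypothesis V0 : (0 < V)%N.
Hypothesis HMV : (H * M <= 2 * V)%N.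
Hypothesis M16 : (M <= 16 * V)%N.

Local Notation L := (8 ^ H)%N.
Local Notation B := (4 * V)%N.
Local Notation h := H.+1.
Local Notation K := (16 * V)%N.

(** The letters to be read depend on the row only, so xi lists them by pairs. *)
Fixpoint route (s : config) (xi : nat -> bool * bool) (y u : nat) (cs : seq nat) : bool :=
  if cs is z :: cs' then
    [&& (u < z <= u + K)%N, s (Run y u z), marked s y (xi y) z & route s xi y.+1 z cs']
  else true.

Lemma route_cat s xi y u cs1 cs2 :
  route s xi y u (cs1 ++ cs2) =
  route s xi y u cs1 && route s xi (y + size cs1) (last u cs1) cs2.
Proof.
elim: cs1 y u => [|z cs1 IHcs] y u /=; first by rewrite addn0.
by rewrite IHcs addnS -addSn !andbA.
Qed.

Lemma grow_route j s xi y A n z :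
  z \in grow L M B j s y A [seq xi i | i <- iota y n] ->
  exists u cs, [/\ u \in A, route s xi y u cs, size cs = n & last u cs = z].
Proof.
elim: n y A => [|n IHn] y A /=; first by move=> zA; exists z, [::].
move=> /IHn[v [cs [/nxt_hit/andP[mv /hasP[u uA /andP[wu ru]]] rcs scs lcs]]].
exists u, (v :: cs); split => //=; last by rewrite scs.
rewrite ru mv rcs !andbT; move: wu => /andP[ou /andP[Lu uM]].
by have := L_gt0 H; lia.
Qed.

Lemma level_route s kt x xi (d : bool) :
  ~~ bad H M V s kt -> x \in core V (home kt) (start H kt) ->
  good H M V (home kt) s (start H kt) x ->
  exists z cs, [/\ z \in core V (home kt + (2 + d)) (start H kt + h),
    good H M V (home kt + (2 + d)) s (start H kt + h) z,
    route s xi (start H kt) x cs, size cs = h & last x cs = z].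
Proof.
move=> /hasPn/(_ x) nbad xc gx; move: nbad => /(_ xc); rewrite gx /= negbK.
set j := home kt; set y := start H kt.
have sw : size [seq xi i | i <- iota y H] = H by rewrite size_map size_iota.
have -> : (y + h = (y + H).+1)%N by rewrite addnS.
move=> /forallP/(_ (tcast sw (in_tuple _)))/forallP/(_ (xi (y + H)%N))/forallP/(_ d).
rewrite val_tcast /= => /hasP[z zc /andP[gz /andP[mz /hasP[u uA /andP[_ ru]]]]].
have xj := core_cols V0 HMV xc; have zj := core_cols V0 HMV zc.
have uj : u \in cols B j.
  by apply: grow_cols uA => v; rewrite inE => /eqP ->.
have [v [cs [vx rcs scs lcs]]] := grow_route uA.
move: vx lcs rcs; rewrite inE => /eqP -> lcs rcs.
exists z, (rcons cs z); split => //; last by rewrite last_rcons.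
- rewrite -cats1 route_cat rcs scs lcs /= ru mz !andbT.
  by have := jump_distance V0 (_ : j * B <= u < j.+1 * B)%N zj; rewrite -mem_cols uj; lia.
- by rewrite size_rcons scs.
Qed.

Lemma survives_route s xi n kt x :
  survives (bad H M V s) n kt -> x \in core V (home kt) (start H kt) ->
  good H M V (home kt) s (start H kt) x ->
  exists cs, route s xi (start H kt) x cs /\ size cs = (n * h)%N.
Proof.
elim: n kt x => [|n IHn] kt x /=; first by move=> _ _ _; exists [::].
move=> /andP[nb S12] xc gx.
have [d Sd] : exists d : bool, survives (bad H M V s) n ((kt.1 + d)%N, kt.2.+1).
  by case/orP: S12 => S; [exists false|exists true]; rewrite ?addn0 ?addn1.
have [z [cs [zc gz rcs scs lcs]]] := level_route xi d nb xc gx.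
have hE : (home kt + (2 + d) = home ((kt.1 + d), kt.2.+1))%N by rewrite /home /=; lia.
have sE : (start H kt + h = start H ((kt.1 + d)%N, kt.2.+1))%N by rewrite /start /= mulSn addnC.
rewrite hE sE in zc gz.
have [cs' [rcs' scs']] := IHn _ z Sd zc gz.
exists (cs ++ cs'); rewrite route_cat rcs lcs scs size_cat scs scs' mulSn; split => //=.
by rewrite sE.
Qed.

End Routes.

Section Cylinders.
Context d (Omega : measurableType d) (R : realType) (P : probability Omega R).
Variables (I : eqType) (X : I -> Omega -> bool) (w : I -> R) (l0 : seq I).
Hypothesis mX : forall i b, i \in l0 -> measurable [set o | X i o = b].

Definition cylinder (J : seq I) (s : I -> bool) : set Omega :=
  [set o | forall i, i \in J -> X i o = s i].

Hypothesis prob_cylinder : forall J s, uniq J -> {subset J <= l0} ->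
  P (cylinder J s) = (\prod_(i <- J) (if s i then w i else 1 - w i))%:E.

Definition mix (l : seq I) (s : I -> bool) (o : Omega) : I -> bool :=
  fun i => if i \in l then X i o else s i.

Lemma cylinder_cons i J s :
  cylinder (i :: J) s = [set o | X i o = s i] `&` cylinder J s.
Proof.
apply/seteqP; split => o /=.
  by move=> h; split; [apply: h; exact: mem_head|move=> j jJ; apply: h; rewrite inE jJ orbT].
by move=> [h1 h2] j; rewrite inE => /predU1P[->//|]; exact: h2.
Qed.

Lemma measurable_cylinder J s : {subset J <= l0} -> measurable (cylinder J s).
Proof.
elim: J => [_|i J IHJ Jl].
  by rewrite (_ : cylinder [::] s = setT) //; apply/seteqP; split => o.
rewrite cylinder_cons; apply: measurableI.
  by apply: mX; apply: Jl; exact: mem_head.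
by apply: IHJ => j jJ; apply: Jl; rewrite inE jJ orbT.
Qed.

(** Disintegration over the bits of l one at a time, starting from bits J already
fixed.  This transfers the elementary expectation to an arbitrary
probability space. *)
Lemma bexp_cylinder l (f : (I -> bool) -> bool) J s :
  uniq (J ++ l) -> {subset J ++ l <= l0} ->
  measurable (cylinder J s `&` [set o | f (mix l s o)]) /\
  P (cylinder J s `&` [set o | f (mix l s o)]) =
  ((\prod_(i <- J) (if s i then w i else 1 - w i)) *
   bexp w l (fun s => (f s)%:R) s)%:E.
Proof.
elim: l J s => [|i l IHl] J s.
  rewrite cats0 => uJ Jl /=; have -> : mix [::] s = fun=> s by apply/funext => o; exact/funext.
  case: (f s) => /=.
    have -> : cylinder J s `&` [set _ | true] = cylinder J s.
      by apply/seteqP; split => o // [].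
    by rewrite mulr1 prob_cylinder//; split => //; exact: measurable_cylinder.
  have -> : cylinder J s `&` [set _ | false] = set0.
    by apply/seteqP; split => o // [].
  by rewrite mulr0 measure0; split.
move=> uJl Jl.
have pJ : perm_eq ((i :: J) ++ l) (J ++ i :: l).
  by change (perm_eq ([:: i] ++ J ++ l) (J ++ [:: i] ++ l)); rewrite perm_catCA.
have u' : uniq ((i :: J) ++ l) by rewrite (perm_uniq pJ).
have l' : {subset (i :: J) ++ l <= l0}.
  by move=> j; rewrite (perm_mem pJ); exact: Jl.
have iJ : i \notin J by move: u' => /= /andP[]; rewrite mem_cat negb_or => /andP[].
have il : i \notin l by move: u' => /= /andP[]; rewrite mem_cat negb_or => /andP[].
have cylE b : cylinder (i :: J) (upd s i b) `&` [set o | f (mix l (upd s i b) o)] =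
   [set o | X i o = b] `&` (cylinder J s `&` [set o | f (mix (i :: l) s o)]).
  rewrite cylinder_cons /= -setIA.
  have -> : [set o | X i o = upd s i b i] = [set o | X i o = b] by rewrite /upd eqxx.
  apply/seteqP; split => o [Xi [cJ fo]]; split => //; split.
  - by move=> j jJ; rewrite (cJ j jJ) /upd; case: eqP => // ji; rewrite -ji jJ in iJ.
  - move: fo => /=; congr (is_true (f _)); apply/funext => j; rewrite /mix inE.
    by case: (boolP (j \in l)) => jl; rewrite ?orbT// orbF /upd; case: eqP => // ->.
  - by move=> j jJ; rewrite (cJ j jJ) /upd; case: eqP => // ji; rewrite -ji jJ in iJ.
  - move: fo => /=; congr (is_true (f _)); apply/funext => j; rewrite /mix inE.
    by case: (boolP (j \in l)) => jl; rewrite ?orbT// orbF /upd; case: eqP => // ->.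
have prodE b : \prod_(j <- i :: J) (if upd s i b j then w j else 1 - w j) =
   (if b then w i else 1 - w i) * \prod_(j <- J) (if s j then w j else 1 - w j).
  rewrite big_cons {1}/upd eqxx; congr (_ * _); apply: eq_big_seq => j jJ.
  by rewrite /upd; case: eqP => // ji; rewrite -ji jJ in iJ.
have [m1 P1] := IHl (i :: J) (upd s i true) u' l'.
have [m0 P0] := IHl (i :: J) (upd s i false) u' l'.
set E := cylinder J s `&` _.
have EU : E = ([set o | X i o = true] `&` E) `|` ([set o | X i o = false] `&` E).
  by apply/seteqP; split => o => [Eo|[[]|[]]//]; case Xi: (X i o); [left|right].
rewrite cylE -/E in m1 P1; rewrite cylE -/E in m0 P0.
split; first by rewrite EU; exact: measurableU.
rewrite EU measureU//; last first.
  by apply/seteqP; split => o // [[/= -> _] [/= ]].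
rewrite [X in (X + _)%E]P1 [X in (_ + X)%E]P0.
rewrite !prodE -EFinD; congr (_%:E) => /=; ring.
Qed.

End Cylinders.

(** * Finite prefixes of words: compactness and measurability *)

Section Konig.
Variables (T : eqType) (Q : seq T -> Prop) (cand : seq T -> seq T) (x0 : T).
Hypothesis Q_prefix : forall p x, Q (rcons p x) -> Q p.
Hypothesis Q_cand : forall p x, Q (rcons p x) -> x \in cand p.

Lemma prefix_cat p q : Q (p ++ q) -> Q p.
Proof.
by elim/last_ind: q => [|q x IHq]; rewrite ?cats0// -rcons_cat => /Q_prefix.
Qed.

(** A prefix is kept when it has extensions of all lengths.  Among the finitely
many one-step extensions of such a prefix, one has the same property. *)
Lemma konig : (forall n, exists p, size p = n /\ Q p) ->
  exists u : nat -> T, forall n, Q (mkseq u n).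
Proof.
move=> Qn; pose ext p := forall n, exists q, size q = n /\ Q (p ++ q).
have extS p : exists x, ext p -> ext (rcons p x).
  case: (pselect (ext p)) => [pe|]; last by exists x0.
  apply: contrapT => /forallNP no.
  have {}no x : exists n, forall q, size q = n -> ~ Q (rcons p x ++ q).
    have /not_implyP[_ /existsNP[n /forallNP nq]] := no x.
    by exists n => q qn Qq; apply: (nq q).
  have [f fP] := choice no.
  have [[|x q] [sq Qq]] := pe (\max_(y <- cand p) f y).+1; first by [].
  rewrite -cat_rcons in Qq.
  have xc : x \in cand p by apply: Q_cand; exact: prefix_cat Qq.
  have fx : (f x <= size q)%N.
    by case: sq => ->; rewrite (big_rem x xc) /= leq_maxl.
  apply: (fP x (take (f x) q)); first by rewrite size_take_min; exact/minn_idPl.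
  by apply: (@prefix_cat _ (drop (f x) q)); rewrite -catA cat_take_drop.
have [nx nxP] := choice extS.
pose g := fix g n := if n is n'.+1 then rcons (g n') (nx (g n')) else [::].
exists (fun n => nx (g n)) => n.
have -> : mkseq (fun n => nx (g n)) n = g n.
  elim: n => // n IHn; rewrite /mkseq -addn1 iotaD map_cat /= -/(mkseq _ _) IHn.
  by rewrite cats1 addn1 add0n.
have : ext (g n).
  elim: n => [|n IHn] /=; last exact: nxP.
  by move=> n; have [p [sp Qp]] := Qn n; exists p.
by move=> /(_ 0%N)[q [_ /prefix_cat]].
Qed.

End Konig.

Lemma fset2_eq (a b c d : vertex) : [fset a; b]%fset = [fset c; d]%fset ->
  (a = c /\ b = d) \/ (a = d /\ b = c).
Proof.
move=> E.
have ha : a \in [fset c; d]%fset by rewrite -E fset21.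
have hb : b \in [fset c; d]%fset by rewrite -E fset22.
have hc : c \in [fset a; b]%fset by rewrite E fset21.
have hd : d \in [fset a; b]%fset by rewrite E fset22.
move: ha hb hc hd; rewrite !inE.
move=> /orP[/eqP ha|/eqP ha] /orP[/eqP hb|/eqP hb] /orP[/eqP hc|/eqP hc] /orP[/eqP hd|/eqP hd];
  by [left; split; congruence|right; split; congruence].
Qed.

Definition origin : vertex := (0, 0).

Section Words.
Variable K : nat.

Definition edge_seen (om : edge -> bool) (v v' : vertex) : Prop :=
  exists e : edge, [/\ val e = [fset v; v']%fset,
    exists2 l : nat, has_length e l & (l <= K)%N & om e].

(** A finite counterpart of [seen_from]; lists of vertices, unlike paths, are
countable. *)
Definition chain (om : edge -> bool) (et : vertex -> bool) (xi : word) (p : seq vertex) : Prop :=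
  [/\ head origin p = origin, uniq p & forall i, (i.+1 < size p)%N ->
    edge_seen om (nth origin p i) (nth origin p i.+1) /\
    et (nth origin p i.+1) = xi i].

Definition sees_prefixes (om : edge -> bool) (et : vertex -> bool) (n : nat) : Prop :=
  forall xi : word, exists p, size p = n.+1 /\ chain om et xi p.

Definition nearby (v : vertex) : seq vertex :=
  [seq (v.1 + i%:Z - K.+1%:Z, v.2 + j%:Z - K.+1%:Z) | i <- iota 0 (2 * K.+2), j <- iota 0 (2 * K.+2)].

Lemma edge_seen_nearby om v v' : edge_seen om v v' -> v' \in nearby v.
Proof.
move=> [e [ve [l le lK] _]]; case: v v' ve => [a b] [a' b'] ve.
have h : `|a - a'| <= K.+1%:Z /\ `|b - b'| <= K.+1%:Z.
  case: le => [[vert _]|].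
    case: vert => x [y1 [y2 [y12]]]; rewrite ve => /fset2_eq[] [[-> ->] [-> ->]]; lia.
  move=> [x1 [x2 [y [x12]]]]; rewrite ve => /fset2_eq[] [[-> ->] [-> ->]]; lia.
pose i := absz (a' - a + K.+1%:Z); pose j := absz (b' - b + K.+1%:Z).
apply/allpairsP; exists (i, j); split.
- change (i \in iota 0 (2 * K.+2)); rewrite mem_iota /i; case: h; lia.
- change (j \in iota 0 (2 * K.+2)); rewrite mem_iota /j; case: h; lia.
- by congr (_, _); rewrite /fst /snd /i /j; case: h; lia.
Qed.

Lemma chain_prefix om et xi p x : chain om et xi (rcons p x) -> chain om et xi p.
Proof.
move=> [hp up cp]; split.
- by case: p hp {up cp}.
- by move: up; rewrite rcons_uniq => /andP[].
- move=> i ip; have := cp i; rewrite size_rcons !nth_rcons ip (ltnW ip) ltnS.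
  by apply; exact: ltnW.
Qed.

Lemma chain_cand om et xi p x : chain om et xi (rcons p x) ->
  x \in (if p is [::] then [:: origin] else nearby (last origin p)).
Proof.
case: p => [[/= -> _ _]|y p]; first exact: mem_head.
move=> [_ _ /(_ (size p))]; rewrite size_rcons /= ltnSn => /(_ isT)[+ _].
rewrite nth_rcons ltnn eqxx -rcons_cons nth_rcons /= ltnSn nth_last.
exact: edge_seen_nearby.
Qed.

(** Compactness: a vertex is joined to finitely many vertices by edges of length at
most K. *)
Lemma words_seenE om et :
  words_seen K om et = [set: word] <-> forall n, sees_prefixes om et n.
Proof.
split=> [W n xi|fin].
  have : words_seen K om et xi by rewrite W.
  move=> [u [u0 ui uP]]; exists (mkseq u n.+1); rewrite size_mkseq; split => //; split => //.
  - by rewrite map_inj_uniq// iota_uniq.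
  - rewrite size_mkseq => i iN; rewrite !nth_mkseq//; last exact: ltnW.
    exact: uP.
apply/seteqP; split => // xi _.
have chains n : exists p, size p = n /\ chain om et xi p.
  by case: n => [|n]; [exists [::]|exact: fin].
have [u uP] := @konig _ (chain om et xi)
  (fun p => if p is [::] then [:: origin] else nearby (last origin p)) origin
  (@chain_prefix om et xi) (@chain_cand om et xi) chains.
exists u; split.
- by have [] := uP 1%N.
- move=> i j ij; have [_ + _] := uP (maxn i j).+1; move=> /mkseq_uniqP; apply => //.
  + by rewrite inE ltnS leq_maxl.
  + by rewrite inE ltnS leq_maxr.
- move=> i; have [_ _ /(_ i)] := uP i.+2; rewrite size_mkseq ltnSn => /(_ isT).
  by rewrite !nth_mkseq.
Qed.

Lemma sees_prefixesS om et n m : (n <= m)%N -> sees_prefixes om et m -> sees_prefixes om et n.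
Proof.
move=> nm W xi; have [p [sp cp]] := W xi; exists (take n.+1 p); split.
  by rewrite size_take_min sp; apply/minn_idPl.
apply: (@prefix_cat _ _ (@chain_prefix om et xi) _ (drop n.+1 p)).
by rewrite cat_take_drop.
Qed.

Section Measurability.
Context d (Omega : measurableType d) (R : realType) (P : probability Omega R).
Variables (omega : edge -> {RV P >-> bool}) (eta : vertex -> {RV P >-> bool}).

Lemma measurable_bit (X : {RV P >-> bool}) b : measurable [set o | X o = b].
Proof.
rewrite (_ : [set o | X o = b] = X @^-1` [set b]) //.
by rewrite -[X in measurable X]setTI; exact: measurable_funP.
Qed.

Lemma measurable_edge_seen v v' : measurable [set o | edge_seen (omega ^~ o) v v'].
Proof.
case: (pselect (exists e : edge, val e = [fset v; v']%fset /\
    exists2 l : nat, has_length e l & (l <= K)%N)) => [[e [ev el]]|no].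
  rewrite (_ : [set o | _] = [set o | omega e o = true]); first exact: measurable_bit.
  apply/seteqP; split => o /= => [[e' [e'v _ oe]]|oe].
    by rewrite (_ : e = e')//; apply: val_inj; rewrite ev e'v.
  by exists e.
rewrite (_ : [set o | _] = set0)//; apply/seteqP; split => o //= [e [ev el _]].
by apply: no; exists e.
Qed.

Lemma measurable_chain xi p : measurable [set o | chain (omega ^~ o) (eta ^~ o) xi p].
Proof.
case: (pselect (head origin p = origin /\ uniq p)) => [[h1 h2]|no]; last first.
  rewrite (_ : [set o | _] = set0)//; apply/seteqP; split => o //= [h1 h2 _].
  exact: no.
rewrite (_ : [set o | _] = \bigcap_(i in [set i | (i.+1 < size p)%N])
   ([set o | edge_seen (omega ^~ o) (nth origin p i) (nth origin p i.+1)] `&`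
    [set o | eta (nth origin p i.+1) o = xi i])).
  apply: bigcap_measurableType => i _; apply: measurableI.
    exact: measurable_edge_seen.
  exact: measurable_bit.
apply/seteqP; split => o /= => [[_ _ h] i ip|h]; first exact: h.
by split.
Qed.

(** Only the first n letters matter, so this is a finite intersection of countable
unions. *)
Lemma measurable_sees_prefixes n :
  measurable [set o | sees_prefixes (omega ^~ o) (eta ^~ o) n].
Proof.
rewrite (_ : [set o | _] = \bigcap_(t in [set: n.-tuple bool])
   \bigcup_(p : seq (int * int)) ([set o | size p = n.+1 /\
      chain (omega ^~ o) (eta ^~ o) (nth false t) (p : seq vertex)])).
  apply: fin_bigcap_measurable; first exact: finite_finset.
  move=> t _; apply: countable_bigcupT_measurable; first exact: countableP.
  move=> p; case: (pselect (size p = n.+1)) => sp.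
    rewrite (_ : [set o | _] = [set o | chain (omega ^~ o) (eta ^~ o) (nth false t) (p : seq vertex)]).
      exact: measurable_chain.
    by apply/seteqP; split => o /= => [[]|].
  by rewrite (_ : [set o | _] = set0)//; apply/seteqP; split => o // [].
apply/seteqP; split => o /= => [W t _|W xi].
  by have [p [sp cp]] := W (nth false t); exists p.
have [p _ /= [sp [h1 h2 h3]]] := W [tuple xi i | i < n] Logic.I.
exists p; split => //; split => // i ip; have [h4 h5] := h3 i ip; split => //.
rewrite h5; have iN : (i < n)%N by rewrite sp in ip.
by rewrite (nth_map (Ordinal iN)) ?size_enum_ord// nth_enum_ord.
Qed.

End Measurability.
End Words.

(** * The bits of the lattice *)

Definition lattice (x y : nat) : vertex := (x%:Z, y%:Z).

Lemma lattice_inj x y x' y' : lattice x y = lattice x' y' -> x = x' /\ y = y'.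
Proof. by move=> [-> ->]. Qed.

Lemma rise_edge x y : edges [fset lattice x y; lattice x y.+1]%fset.
Proof. by left; exists x%:Z, y%:Z, y.+1%:Z; split => //; lia. Qed.

Lemma run_edge y u z : (u < z)%N -> edges [fset lattice u y; lattice z y]%fset.
Proof.
move=> uz; right; exists (z - u)%N; first by rewrite /= subn_gt0.
by exists u%:Z, z%:Z, y%:Z; split => //; lia.
Qed.

Definition rise (x y : nat) : edge :=
  exist (fun e => e \in edges) _ (mem_set (rise_edge x y)).

Definition run (y u z : nat) : edge :=
  insubd (rise 0 0) [fset lattice u y; lattice z y]%fset.

Lemma val_run y u z : (u < z)%N -> val (run y u z) = [fset lattice u y; lattice z y]%fset.
Proof. by move=> uz; rewrite val_insubd mem_set//; exact: run_edge. Qed.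

Definition entry (c : coord) : edge + vertex :=
  match c with
  | Site x y => inr (lattice x y)
  | Rise x y => inl (rise x y)
  | Run y u z => inl (run y u z)
  end.

Lemma entry_inj X Y : {in box X Y &, injective entry}.
Proof.
move=> c c'; rewrite !mem_box.
case: c c' => [x y|x y|y u z] [x' y'|x' y'|y' u' z'] //=.
- by move=> _ _ [-> ->].
- by move=> _ _ [/fset2_eq[] [/lattice_inj[? ?] /lattice_inj[? ?]]]; subst; [|lia].
- move=> _ /andP[uz _] [/(congr1 val)]; rewrite val_run//.
  by move=> /fset2_eq[] [/lattice_inj[? ?] /lattice_inj[? ?]]; lia.
- move=> /andP[uz _] _ [/(congr1 val)]; rewrite val_run//.
  by move=> /fset2_eq[] [/lattice_inj[? ?] /lattice_inj[? ?]]; lia.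
- move=> /andP[uz _] /andP[uz' _] [/(congr1 val)]; rewrite !val_run//.
  by move=> /fset2_eq[] [/lattice_inj[? ?] /lattice_inj[? ?]]; subst; [|lia].
Qed.

Section Law.
Context (R : realType) d (Omega : measurableType d) (P : probability Omega R).
Variables (K : nat) (p eps : R) (p_ : nat -> R).
Variables (omega : edge -> {RV P >-> bool}) (eta : vertex -> {RV P >-> bool}).
Hypothesis law : percolation_law K p eps p_ omega eta.

Definition truncated (i : nat) : R := if (i <= K)%N then p_ i else 0.

Definition component (c : edge + vertex) : {RV P >-> bool} :=
  match c with inl e => omega e | inr v => eta v end.

Definition state (c : coord) (o : Omega) : bool := component (entry c) o.

Lemma prob_state X Y c b : c \in box X Y ->
  P (component (entry c) @^-1` [set b]) =
  (if b then weight p eps truncated c else 1 - weight p eps truncated c)%:E.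
Proof.
move=> cl; have [_ vert hor vtx] := law.
have Pt : P (component (entry c) @^-1` [set true]) = (weight p eps truncated c)%:E.
  case: c cl => [x y|x y|y u z] /=; first by move=> _; exact: vtx.
    by move=> _; apply: vert => /=; exists x%:Z, y%:Z, y.+1%:Z; split => //; lia.
  rewrite mem_box => /andP[uz _]; rewrite uz; apply: hor; rewrite val_run//.
  by exists u%:Z, z%:Z, y%:Z; split => //; lia.
case: b => //.
have -> : component (entry c) @^-1` [set false] = ~` (component (entry c) @^-1` [set true]).
  apply/seteqP; split => o /=; first by move=> ->.
  by case: (component _ o) => // h; case: h.
by rewrite probability_setC ?Pt//; exact: measurable_bit.
Qed.

Lemma prob_cylinder_box X Y (J : seq coord) s : uniq J -> {subset J <= box X Y} ->
  P (cylinder state J s) =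
  (\prod_(c <- J) (if s c then weight p eps truncated c else 1 - weight p eps truncated c))%:E.
Proof.
move=> uJ Jl; have [indep _ _ _] := law.
have inj : {in J &, injective entry} by move=> c c' /Jl cl /Jl cl'; exact: entry_inj cl cl'.
pose J' : {fset (edge + vertex)%type} := seq_fset tt (map entry J).
pose B (i : (edge + vertex)%type) : set bool := [set b | forall c, c \in J -> entry c = i -> b = s c].
have BE c : c \in J -> B (entry c) = [set s c].
  move=> cJ; apply/seteqP; split => b /=; first by move=> h; exact: h.
  by move=> -> c' c'J /inj ->.
have -> : cylinder state J s = \bigcap_(i in [set` J']) (component i @^-1` B i).
  apply/seteqP; split => o /= h.
    move=> i /=; rewrite seq_fsetE => /mapP[c cJ ->]; rewrite BE//; exact: h.
  move=> c cJ; have := h (entry c); rewrite /= seq_fsetE map_f// => /(_ isT).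
  by rewrite BE.
rewrite (indep J' B)//.
rewrite (perm_big _ (seq_fset_perm _ _)) /= undup_id ?map_inj_in_uniq// big_map.
rewrite (big_morph EFin (@EFinM R) (erefl _)); apply: eq_big_seq => c cJ; rewrite BE//; apply: prob_state.
exact: Jl cJ.
Qed.

End Law.

Lemma route_nth V s xi y u cs i : route V s xi y u cs -> (i < size cs)%N ->
  let v := nth 0%N (u :: cs) i in let z := nth 0%N cs i in
  [/\ (v < z <= v + 16 * V)%N, s (Run (y + i) v z) & marked s (y + i) (xi (y + i)%N) z].
Proof.
elim: cs y u i => [|z cs IHcs] y u [|i] //=.
  by move=> /and4P[uz ru mz _] _; rewrite addn0.
by move=> /and4P[uz ru mz rcs] isz; have := IHcs _ _ _ rcs isz; rewrite addSnnS.
Qed.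

Section RouteChain.
Variables (V X Y : nat) (om : edge -> bool) (et : vertex -> bool).

(** Bits outside the box are false.  The edges of a route, being open, lie inside
the box, and so do the letters read along them. *)
Definition observed (c : coord) : bool :=
  if c \in box X Y then
    match entry c with inl e => om e | inr v => et v end
  else false.

Lemma route_chain xi cs :
  route V observed (fun y => (xi (2 * y)%N, xi (2 * y).+1)) 0 0 cs ->
  exists p, size p = (2 * size cs).+1 /\ chain (16 * V) om et xi p.
Proof.
move=> rcs; pose c i := nth 0%N (0%N :: cs) i.
have cP i : (i < size cs)%N -> [/\ (c i < c i.+1 <= c i + 16 * V)%N,
    om (run i (c i) (c i.+1)), om (rise (c i.+1) i),
    et (lattice (c i.+1) i) = xi (2 * i)%N & et (lattice (c i.+1) i.+1) = xi (2 * i).+1].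
  move=> ics; have [vz rv mz] := route_nth rcs ics.
  rewrite -/(c i) -/(c i.+1) add0n in vz rv mz; split => //.
  - by move: rv; rewrite /observed; case: ifP.
  - by move: mz => /and4P[_ _ + _]; rewrite /observed; case: ifP.
  - move: mz rv => /and4P[_ /eqP /= <- _ _]; rewrite /observed !mem_box.
    by case: ifP => // /and3P[_ -> iY] _; rewrite (ltnW iY).
  - move: mz rv => /and4P[_ _ _ /eqP /= <-]; rewrite /observed !mem_box.
    by case: ifP => // /and3P[_ -> ->] _.
have c_lt i j : (i < j)%N -> (j <= size cs)%N -> (c i < c j)%N.
  elim: j => // j IHj; rewrite ltnS leq_eqVlt => /predU1P[->|ij] jcs.
    by have [/andP[]] := cP j jcs.
  by apply: ltn_trans (IHj ij (ltnW jcs)) _; have [/andP[]] := cP j jcs.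
have c_inj i j : (i <= size cs)%N -> (j <= size cs)%N -> c i = c j -> i = j.
  move=> ics jcs cij; case: (ltngtP i j) => // ij; exfalso.
    by have := c_lt i j ij jcs; rewrite cij ltnn.
  by have := c_lt j i ij ics; rewrite cij ltnn.
(* Vertices of even index are (c y, y), those of odd index (c (y+1), y). *)
pose u i := lattice (c (uphalf i)) (i./2).
exists (mkseq u (2 * size cs).+1); rewrite size_mkseq; split => //; split => //.
- apply/mkseq_uniqP => i j; rewrite !inE => iN jN /lattice_inj[/c_inj e1 e2].
  by have {}e1 := e1 _ _; rewrite (uphalfE i) (uphalfE j) in e1; lia.
- move=> i; rewrite size_mkseq => iN; rewrite !nth_mkseq//; last exact: ltnW.
  have ics : (i./2 < size cs)%N by lia.
  have [/andP[c1 c2] o1 o2 e1 e2] := cP _ ics.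
  case: (boolP (odd i)) => oi.
    have iE : i = (2 * i./2).+1 by lia.
    have h1 : uphalf i = (i./2).+1 by lia.
    have h2 : uphalf i.+1 = (i./2).+1 by lia.
    have h3 : (i.+1)./2 = (i./2).+1 by lia.
    rewrite /u h1 h2 h3; split; last by rewrite e2 -iE.
    exists (rise (c (i./2).+1) i./2); split => //.
    exists 1%N; last by lia.
    by left; split => //=; exists (c (i./2).+1)%:Z, (i./2)%:Z, (i./2).+1%:Z; split => //; lia.
  have iE : i = (2 * i./2)%N by lia.
  have h1 : uphalf i = i./2 by lia.
  have h2 : uphalf i.+1 = (i./2).+1 by lia.
  have h3 : (i.+1)./2 = i./2 by lia.
  rewrite /u h1 h2 h3; split; last by rewrite e1 -iE.
  exists (run i./2 (c i./2) (c (i./2).+1)); split => //; first by rewrite val_run.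
  exists (c (i./2).+1 - c i./2)%N; last by lia.
  right; rewrite val_run//; exists (c i./2)%:Z, (c (i./2).+1)%:Z, (i./2)%:Z; split => //; lia.
Qed.

End RouteChain.

(** * Choice of the scales *)

Lemma sum_odd (R : realFieldType) (x : R) a k :
  \sum_(2 * a <= i < 2 * a + 2 * k | odd i) x = k%:R * x.
Proof.
elim: k => [|k IHk]; first by rewrite muln0 addn0 big_geq// mul0r.
rewrite mulnS addnCA 2!addSn add0n big_mkcond 2?big_nat_recr/= -?big_mkcond/= ?IHk;
  [|lia|lia].
have -> : odd (2 * a + 2 * k) = false by lia.
by rewrite /= addr0 -natr1; ring.
Qed.

Lemma rate_dyadic (R : realType) j : (0 < j)%N ->
  (4 * j.+1)%:R^-1 <= \sum_(2 ^ j <= i < 2 ^ j.+1 | odd i) rate R i.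
Proof.
case: j => // j _.
apply: (@le_trans _ _ (\sum_(2 ^ j.+1 <= i < 2 ^ j.+2 | odd i) (2 ^ j.+2 * j.+2)%:R^-1)).
  have -> : (2 ^ j.+2 = 2 * 2 ^ j + 2 * 2 ^ j)%N by rewrite !expnS; lia.
  rewrite {1}expnS sum_odd le_eqVlt; apply/orP; left; apply/eqP.
  have -> : (2 * 2 ^ j + 2 * 2 ^ j = 4 * 2 ^ j)%N by lia.
  have n0 : (2 ^ j)%:R != 0 :> R by rewrite pnatr_eq0 expn_eq0.
  have m0 : j.+2%:R != 0 :> R by rewrite pnatr_eq0.
  move: (2 ^ j)%N (j.+2) n0 m0 => a b a0 b0.
  by rewrite !natrM; field; rewrite a0 b0.
rewrite big_nat_cond [leRHS]big_nat_cond; apply: ler_sum => i /andP[/andP[i1 i2] _].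
rewrite /rate (@trunc_log_eq 2 j.+1)//; last by rewrite i1.
have i0 : (0 < i)%N by apply: leq_trans i1; rewrite expn_gt0.
have p0 : (0 < 2 ^ j.+2)%N by rewrite expn_gt0.
rewrite lef_pV2 ?posrE ?ltr0n; [|by rewrite muln_gt0 p0|by rewrite muln_gt0 i0].
by rewrite ler_nat leq_mul2r (ltnW i2) orbT.
Qed.

(** Each of the dyadic intervals from 2^j to 2^(j+1), with n <= j < 2n, has mass at
least 1/(4(j+1)) >= 1/(8n). *)
Lemma rate_octave (R : realType) n : (0 < n)%N ->
  8^-1 <= \sum_(2 ^ n <= i < 2 ^ (n * 2) | odd i) rate R i.
Proof.
move=> n0; have n0R : 0 < n%:R :> R by rewrite ltr0n.
have step m : (m <= n)%N ->
    m%:R * (8 * n%:R)^-1 <= \sum_(2 ^ n <= i < 2 ^ (n + m) | odd i) rate R i.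
  elim: m => [|m IHm] mn; first by rewrite addn0 big_geq// mul0r.
  rewrite (@big_cat_nat _ _ _ (2 ^ (n + m)))/=; [|by rewrite leq_exp2l// leq_addr|
    by rewrite leq_exp2l// addnS].
  rewrite -natr1 mulrDl mul1r lerD ?IHm//; first exact: ltnW.
  rewrite addnS; apply: le_trans (rate_dyadic _ _); last by rewrite addn_gt0 n0.
  rewrite -natrM lef_pV2 ?posrE ?ltr0n ?muln_gt0// ler_nat; lia.
have := step n (leqnn n); rewrite addnn -muln2; apply: le_trans.
by rewrite le_eqVlt; apply/orP; left; apply/eqP; field; rewrite gt_eqF.
Qed.

(** The exponent of the right end doubles with each unit of D, and each doubling
gains 1/8: this is the divergence of the sum of 1/(i log i), in a form
uniform in n. *)
Lemma rate_mass (R : realType) n D : (0 < n)%N ->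
  D%:R / 8 <= \sum_(0 <= i < 2 ^ (n * 2 ^ D) | odd i && (2 ^ n <= i)%N) rate R i.
Proof.
move=> n0.
have h : D%:R / 8 <= \sum_(2 ^ n <= i < 2 ^ (n * 2 ^ D) | odd i) rate R i.
  elim: D => [|D IHD]; first by rewrite expn0 muln1 big_geq// mul0r.
  have nD : (n <= n * 2 ^ D)%N by rewrite leq_pmulr// expn_gt0.
  rewrite expnS mulnCA mulnC (@big_cat_nat _ _ _ (2 ^ (n * 2 ^ D)))/=;
    [|by rewrite leq_exp2l|by rewrite leq_exp2l//; lia].
  rewrite -natr1 mulrDl mul1r lerD// rate_octave//; lia.
apply: le_trans h _.
rewrite [leRHS](@big_cat_nat _ _ _ (2 ^ n))//=; last first.
  by rewrite leq_exp2l// leq_pmulr// expn_gt0.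
rewrite -[leLHS]add0r lerD ?sumr_ge0//; first by move=> *; exact: rate_ge0.
rewrite big_nat_cond [leRHS]big_nat_cond le_eqVlt; apply/orP; left; apply/eqP.
by apply: eq_bigl => i; case: (2 ^ n <= i)%N; rewrite ?andbT ?andbF.
Qed.

Lemma rate_le_log (R : realType) i : (1 < i)%N -> rate R i <= (i%:R * ln i%:R)^-1.
Proof.
move=> i1; have i0 : 0 < i%:R :> R by rewrite ltr0n; lia.
have l0 : 0 < ln i%:R :> R by rewrite ln_gt0// ltr1n.
rewrite /rate lef_pV2 ?posrE; [|by rewrite ltr0n muln_gt0 andbT; lia|by rewrite mulr_gt0].
rewrite natrM ler_wpM2l ?(ltW i0)//.
apply: (@le_trans _ _ (ln (2 ^+ (trunc_log 2 i).+1))).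
  by rewrite ler_ln ?posrE ?exprn_gt0// -natrX ler_nat ltnW// trunc_log_ltn.
rewrite lnXn// -[leLHS]mulr_natl -[leRHS]mulr1 ler_wpM2l//.
have := @le_ln1Dx R 1; rewrite (_ : 1 + 1 = 2)//; apply; lra.
Qed.

Lemma survives_eq b b' n kt :
  (forall x, (x.1 < kt.1 + n)%N -> (x.2 < kt.2 + n)%N -> b x = b' x) ->
  survives b n kt = survives b' n kt.
Proof.
elim: n kt => //= n IHn kt bb'; rewrite bb' ?addnS ?ltnS ?leq_addr//.
by congr (_ && (_ || _)); apply: IHn => x /= x1 x2; apply: bb'; lia.
Qed.

(** With L = 8^H, the window ends at M = L^(2^D), so a block has length
exp(O(H)) and rJ is of order 1/(V H).  The exponent q V L rJ / 4 is then of order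
8^H/H and beats the logarithm, of order H, of the prefactor. *)
Lemma choose_scale (R : realType) (q lam : R) (D n0 : nat) : 0 < q -> 0 < lam ->
  exists H, let M := (2 ^ (3 * H * 2 ^ D))%N in let V := (2 ^ H * M)%N in
    exists rJ : R,
    [/\ (0 < H)%N, (n0 <= 8 ^ H)%N, 0 <= rJ,
       forall i, (4 * V <= i <= 4 * (4 * V))%N -> rJ <= rate R i &
       (8 ^ H)%:R * rJ <= 1 /\
       (V * 4 ^ H * 8)%:R * expR (- (q / 4 * (V%:R * ((8 ^ H)%:R * rJ)))) <= lam^-1].
Proof.
(* H * c bounds the binary logarithms both of 16 V and of the prefactor
   V * 4^H * 8. *)
move=> q0 lam0; pose c := (6 + 3 * 2 ^ D)%N.
have c0 : 0 < c%:R :> R by rewrite ltr0n.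
pose x := 64 * c%:R * (c%:R + lam) / q.
have x0 : 0 <= x by rewrite divr_ge0 ?mulr_ge0 ?addr_ge0// ltW.
pose H := maxn (maxn 1 n0) (Num.bound x).
have H1 : (0 < H)%N by lia.
have Hn : (n0 <= H)%N by lia.
have xH : x <= H%:R.
  apply: (@le_trans _ _ (Num.bound x)%:R); first exact/ltW/archi_boundP.
  by rewrite ler_nat leq_maxr.
exists H => M V.
have H2 : (H <= 2 ^ H)%N by apply: ltnW; exact: ltn_expl.
have E8 : (8 ^ H = 2 ^ H * 2 ^ H * 2 ^ H)%N by rewrite -!expnMn.
have P2 : (0 < 2 ^ H)%N by rewrite expn_gt0.
have M8 : (8 ^ H <= M)%N.
  rewrite (_ : 8 = 2 ^ 3)%N// -expnM leq_exp2l// leq_pmulr// expn_gt0//.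
have V8 : (8 ^ H <= V)%N by apply: leq_trans M8 _; rewrite leq_pmull.
have V0 : (0 < V)%N by rewrite muln_gt0 P2 expn_gt0.
have VE : V = (2 ^ (H + 3 * H * 2 ^ D))%N by rewrite /V /M -expnD.
have HR : 0 < H%:R :> R by rewrite ltr0n.
have VR : 0 < V%:R :> R by rewrite ltr0n.
exists (16 * V%:R * (H%:R * c%:R))^-1; split => //.
- by apply: leq_trans Hn _; apply: leq_trans H2 _; rewrite E8 -mulnA leq_pmulr// muln_gt0 P2.
- move=> i /andP[i1 i2].
  have i0 : (0 < i)%N by lia.
  rewrite /rate lef_pV2 ?posrE; [|by rewrite !mulr_gt0|by rewrite ltr0n muln_gt0 i0].
  rewrite -!natrM ler_nat leq_mul//; first by clear - i2; lia.
  have il : (i <= 2 ^ (H + 3 * H * 2 ^ D + 4))%N by rewrite expnD -VE; lia.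
  have := leq_trunc_log 2 il; rewrite trunc_expnK// => t.
  by rewrite /c mulnDr; nia.
split.
  rewrite ler_pdivrMr ?mulr_gt0// mul1r -!natrM ler_nat.
  by apply: leq_trans V8 _; rewrite -mulnA mulnCA leq_pmulr// !muln_gt0 H1.
have e1 : V%:R * ((8 ^ H)%:R * (16 * V%:R * (H%:R * c%:R))^-1) =
   (8 ^ H)%:R / (16 * H%:R * c%:R) :> R.
  by field; rewrite !gt_eqF.
rewrite e1.
have e2 : (V * 4 ^ H * 8)%:R <= expR (H%:R * c%:R) :> R.
  apply: (@le_trans _ _ (2 ^ (H * c))%:R).
    rewrite ler_nat VE (_ : 4 = 2 ^ 2)%N// (_ : 8 = 2 ^ 3)%N// -expnM -!expnD leq_exp2l//.
    by rewrite /c; nia.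
  rewrite -natrM -[X in expR X]mulr1 expRM_natl natrX; apply: lerXn2r; rewrite ?nnegrE ?expR_ge0//.
  by have := expR_ge1Dx (1 : R); apply: le_trans; lra.
apply: (@le_trans _ _ (expR (H%:R * c%:R) * expR (- (q / 4 * ((8 ^ H)%:R / (16 * H%:R * c%:R)))))).
  by rewrite ler_wpM2r ?expR_ge0.
rewrite -expRD; apply: (@le_trans _ _ (expR (- lam))); last first.
  rewrite expRN lef_pV2 ?posrE ?expR_gt0//.
  by apply: le_trans (expR_ge1Dx _); rewrite lerDr ler01.
rewrite ler_expR.
have h3 : H%:R ^+ 3 <= (8 ^ H)%:R :> R.
  by rewrite -natrX ler_nat E8 !expnS expn0 muln1 mulnA !leq_mul.
have h4 : H%:R * (c%:R + lam) <= q / 4 * ((8 ^ H)%:R / (16 * H%:R * c%:R)).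
  have -> : q / 4 * ((8 ^ H)%:R / (16 * H%:R * c%:R)) = q * (8 ^ H)%:R / (64 * c%:R * H%:R).
    by field; rewrite !gt_eqF.
  rewrite ler_pdivlMr ?mulr_gt0//.
  have xq : x * q = 64 * c%:R * (c%:R + lam) by rewrite /x -mulrA mulVf ?mulr1// gt_eqF.
  apply: (@le_trans _ _ (q * H%:R ^+ 3)); last by rewrite ler_wpM2l// ltW.
  have -> : H%:R * (c%:R + lam) * (64 * c%:R * H%:R) = (H%:R ^+ 2) * (x * q).
    by rewrite xq; ring.
  have -> : q * H%:R ^+ 3 = H%:R ^+ 2 * (H%:R * q) by ring.
  by rewrite ler_wpM2l ?exprn_ge0// ler_wpM2r// ltW.
have : 1 * lam <= H%:R * lam by rewrite ler_wpM2r ?(ltW lam0)// ler1n.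
by move: h4; rewrite mulrDr mul1r; lra.
Qed.

(** * Positive probability *)

Section LowerBound.
Variables (R : realType) (p eps : R) (p_ : nat -> R).
Hypothesis p01 : 0 < p < 1.
Hypothesis eps01 : 0 < eps <= 1.
Variables (H M V : nat).
Local Notation K := (16 * V)%N.
Local Notation L := (8 ^ H)%N.
Local Notation B := (4 * V)%N.
Local Notation h := H.+1.
Local Notation tp := (truncated K p_).
Hypothesis p_01 : forall i, (0 < i)%N -> 0 <= tp i <= 1.
Hypothesis V0 : (0 < V)%N.
Hypothesis HMV : (H * M <= 2 * V)%N.
Hypothesis M16 : (M <= 16 * V)%N.
Hypothesis rate_p : forall i, (L <= i < M)%N -> rate R i <= tp i.
Variables (lam m rJ : R).
Hypothesis lam0 : 0 < lam.
Hypothesis lam33 : 33 / lam <= 6^-1 ^+ 24.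
Hypothesis lam8 : 8 / lam <= 4^-1.
Hypothesis lam_m : lam + 8 <= mark_rate p eps * m / 4.
Hypothesis mass : m <= \sum_(0 <= i < M | odd i && (L <= i)%N) rate R i.
Hypothesis rJ0 : 0 <= rJ.
Hypothesis rJ_p : forall i, (B <= i <= 4 * B)%N -> rJ <= tp i.
Hypothesis rJ_L : L%:R * rJ <= 1.
Hypothesis rJ_jump : (V * 4 ^ H * 8)%:R *
  expR (- (mark_rate p eps / 4 * (V%:R * (L%:R * rJ)))) <= lam^-1.

Variable N : nat.
Hypothesis N0 : (0 < N)%N.
Let X := ((3 * N + 4) * B)%N.
Let Y := ((N + 2) * h)%N.

Definition thriving_start (s : config) : bool :=
  survives (bad H M V s) N (0, 0)%N && good H M V 0 s 0 0.

Definition residue (kt : nat * nat) : 'I_4 * 'I_2 :=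
  (Ordinal (ltn_pmod kt.1 (isT : 0 < 4)%N), Ordinal (ltn_pmod kt.2 (isT : 0 < 2)%N)).

(** The value 2^-1 is uniform in N: it bounds 1 - 1/18 - 8/lam from below. *)
Lemma thriving_start_prob :
  2^-1 <= bexp (weight p eps tp) (box X Y) (fun s => (thriving_start s)%:R) (fun=> false).
Proof.
have w01 := weight01 p01 eps01 p_01.
(* Only sites with both coordinates below N are visited within N levels; the
   bits of these are all in the box. *)
pose inside (kt : nat * nat) := (kt.1 < N)%N && (kt.2 < N)%N.
pose bd s kt := inside kt && bad H M V s kt.
have survE s : survives (bad H M V s) N (0, 0)%N = survives (bd s) N (0, 0)%N.
  by apply: survives_eq => x /= x1 x2; rewrite /bd /inside x1 x2.
have bad_rare kt : bexp (weight p eps tp) (box X Y) (fun s => (bd s kt)%:R) (fun=> false)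
    <= 6^-1 ^+ (3 * #|{: 'I_4 * 'I_2}|).
  rewrite card_prod !card_ord /bd; case: (boolP (inside kt)) => [/andP[k1 k2]|_] /=; last first.
    by rewrite bexp_cst exprn_ge0.
  apply: le_trans (bad_le p01 eps01 p_01 V0 HMV lam0 rate_p lam_m mass rJ0 rJ_p rJ_L rJ_jump _ _) _.
  - by rewrite leq_mul2r; apply/orP; right; rewrite /home; clear - k1 k2; lia.
  - by rewrite /start /Y -mulnDl leq_mul2r; apply/orP; right; clear - k1 k2; lia.
  - exact: lam33.
have C0 : (0 < #|{: 'I_4 * 'I_2}|)%N by rewrite card_prod !card_ord.
have bd_dep kt : depends_on (cells H V kt) (fun s => bd s kt).
  by move=> s s' ss'; rewrite /bd; congr (_ && _); exact: bad_dep ss'.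
have cl_disj x y i : x != y -> residue x = residue y -> cells H V x i -> ~~ cells H V y i.
  by move=> xy [e4 e2]; apply: cells_disjoint.
have t0 : 0 < (6^-1 : R) <= 6^-1 by rewrite invr_gt0 lexx ltr0n.
have survP := peierls w01 bd_dep cl_disj t0 C0 bad_rare N (0, 0)%N.
have goodP : bexp (weight p eps tp) (box X Y) (fun s => (~~ good H M V 0 s 0 0)%:R) (fun=> false)
    <= 8 / lam.
  apply: (good_fail p01 eps01 p_01 V0 HMV lam0 rate_p lam_m mass).
  - by apply/mapP; exists 0%N => //; rewrite mem_iota.
  - by rewrite /X leq_mul2r; apply/orP; right; clear - N0; lia.
  - by rewrite /Y mulnDl; clear - N0; lia.
have le1 s : 1 - 1 * ((~~ survives (bd s) N (0, 0)%N)%:R + (~~ good H M V 0 s 0 0)%:R) <=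
    (thriving_start s)%:R :> R.
  by rewrite /thriving_start survE; case: survives; case: good; rewrite /=; lra.
apply: le_trans (ler_bexp w01 _ _ le1); rewrite bexpC1 bexpD.
move: survP (le_trans goodP lam8); rewrite mul1r; set a := bexp _ _ _ _; set b := bexp _ _ _ _; lra.
Qed.

Section Prefixes.
Context d (Omega : measurableType d) (P : probability Omega R).
Variables (omega : edge -> {RV P >-> bool}) (eta : vertex -> {RV P >-> bool}).
Hypothesis law : percolation_law K p eps p_ omega eta.

Lemma sees_prefixes_prob :
  ((2^-1)%:E <= P [set o | sees_prefixes K (omega ^~ o) (eta ^~ o) N])%E.
Proof.
have mX c b : c \in box X Y -> measurable [set o | state omega eta c o = b].
  by move=> _; exact: measurable_bit.
have [mE PE] := @bexp_cylinder _ _ _ P _ (state omega eta) (weight p eps tp) (box X Y) mX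
  (@prob_cylinder_box _ _ _ _ _ _ _ _ _ _ law X Y) (box X Y) thriving_start [::] (fun=> false)
  (box_uniq X Y) (fun _ cX => cX).
rewrite big_nil mul1r in PE.
apply: (@le_trans _ _ (P (cylinder (state omega eta) [::] (fun=> false) `&`
    [set o | thriving_start (mix (state omega eta) (box X Y) (fun=> false) o)]))).
  by rewrite PE lee_fin; exact: thriving_start_prob.
apply: le_measure; rewrite ?inE//; first exact: measurable_sees_prefixes.
move=> o [_ /= /andP[surv g0]] xi.
set s := mix _ _ _ _ in surv g0.
have sE : s = observed X Y (omega ^~ o) (eta ^~ o).
  by apply/funext => c; rewrite /s /mix /observed /state; case: ifP => // _; case: (entry c).
have c0 : 0%N \in core V (home (0, 0)%N) (start H (0, 0)%N).
  by apply/mapP; exists 0%N => //; rewrite mem_iota.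
have [cs [rcs scs]] :=
  survives_route V0 HMV M16 (fun y => (xi (2 * y)%N, xi (2 * y).+1)) surv c0 g0.
rewrite sE in rcs; have [w [sw cw]] := route_chain rcs.
exists (take N.+1 w); split.
  by rewrite size_take_min sw; apply/minn_idPl; rewrite scs ltnS mulnCA leq_pmulr.
apply: (@prefix_cat _ _ (@chain_prefix K _ _ xi) _ (drop N.+1 w)).
by rewrite cat_take_drop.
Qed.

End Prefixes.

End LowerBound.

Theorem theorem1 (R : realType) (p_ : nat -> R)
    (hp01 : forall i : nat, (0 < i)%N -> 0 <= p_ i <= 1)
    (hplog : \forall i \near \oo, (i%:R * ln i%:R)^-1 <= p_ i)
    (p : R) (hp : 0 < p < 1) (eps : R) (heps : 0 < eps <= 1) :
  exists K : nat, (0 < K)%N /\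
    forall (d : measure_display) (Omega : measurableType d)
      (P : probability Omega R)
      (omega : edge -> {RV P >-> bool}) (eta : vertex -> {RV P >-> bool}),
      percolation_law K p eps p_ omega eta ->
      (0 < P [set w | words_seen K (omega ^~ w) (eta ^~ w) = [set: word]])%E.
Proof.
have [n0 _ hn0] := hplog.
have [lam [lam0 lam33 lam8]] : exists lam : R,
    [/\ 0 < lam, 33 / lam <= 6^-1 ^+ 24 & 8 / lam <= 4^-1].
  exists (33 / 6^-1 ^+ 24).
  have : 0 < 6^-1 ^+ 24 :> R by rewrite exprn_gt0// invr_gt0.
  have : 6^-1 ^+ 24 <= 6^-1 :> R.
    by rewrite -[leRHS]expr1 ler_wiXn2l ?invr_ge0// invf_le1 ?ler1n.
  move: (6^-1 ^+ 24) => t t6 t0; split.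
  - by rewrite divr_gt0.
  - by rewrite invf_div mulrCA divff// mulr1.
  - by rewrite invf_div; lra.
have q0 := mark_rate_gt0 hp heps; set q := mark_rate p eps in q0.
pose m := (lam + 8) * 4 / q.
have lam_m : lam + 8 <= q * m / 4.
  by rewrite le_eqVlt; apply/orP; left; apply/eqP; rewrite /m; field; rewrite gt_eqF.
pose D := Num.bound (8 * m).
have mD : m <= D%:R / 8.
  have m0 : 0 <= m by rewrite /m divr_ge0 ?(ltW q0)// mulr_ge0// addr_ge0// ltW.
  by rewrite ler_pdivlMr// mulrC; apply/ltW/archi_boundP; rewrite mulr_ge0.
have [H] := choose_scale D (maxn n0 2) q0 lam0.
set M := (2 ^ (3 * H * 2 ^ D))%N; set V := (2 ^ H * M)%N => -[rJ [H0 n0H rJ0 rJ_rate [rJ_L rJ_jump]]].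
have P2 : (0 < 2 ^ H)%N by rewrite expn_gt0.
have M0 : (0 < M)%N by rewrite expn_gt0.
have V0 : (0 < V)%N by rewrite muln_gt0 P2.
have MV : (M <= V)%N by rewrite leq_pmull.
have H2 : (H <= 2 ^ H)%N by apply: ltnW; exact: ltn_expl.
have HMV : (H * M <= 2 * V)%N.
  by apply: (@leq_trans V); rewrite ?leq_pmull// leq_mul2r H2 orbT.
have M16 : (M <= 16 * V)%N by apply: (leq_trans MV); rewrite leq_pmull.
pose tp := truncated (16 * V) p_.
have tp01 i : (0 < i)%N -> 0 <= tp i <= 1.
  by rewrite /tp /truncated; case: ifP => [_|_ _]; [exact: hp01|rewrite lexx ler01].
have rate_tp i : (8 ^ H <= i <= 16 * V)%N -> rate R i <= tp i.
  move=> /andP[i1 i2]; rewrite /tp /truncated i2.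
  apply: le_trans (rate_le_log _ _) _; first by apply: leq_trans i1; apply: leq_trans n0H; rewrite leq_maxr.
  by apply: hn0 => /=; apply: leq_trans i1; apply: leq_trans n0H; rewrite leq_maxl.
have rate_window i : (8 ^ H <= i < M)%N -> rate R i <= tp i.
  by move=> /andP[i1 iM]; apply: rate_tp; rewrite i1 (leq_trans (ltnW iM)).
have V8 : (8 ^ H <= V)%N.
  apply: leq_trans MV; rewrite (_ : 8 = 2 ^ 3)%N// -expnM leq_exp2l// leq_pmulr//.
  by rewrite expn_gt0.
have rJ_p i : (4 * V <= i <= 4 * (4 * V))%N -> rJ <= tp i.
  move=> iV; apply: le_trans (rJ_rate i iV) _; apply: rate_tp.
  case/andP: iV => i1; rewrite mulnA => ->; rewrite andbT.
  by apply: leq_trans V8 (leq_trans _ i1); rewrite leq_pmull.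
have mass : m <= \sum_(0 <= i < M | odd i && (8 ^ H <= i)%N) rate R i.
  apply: le_trans mD _; apply: le_trans (rate_mass R D (_ : 0 < 3 * H)%N) _; first by rewrite muln_gt0.
  by rewrite /M (_ : 8 = 2 ^ 3)%N// -expnM.
exists (16 * V)%N; split; first by rewrite muln_gt0.
move=> d Omega P omega eta law.
pose S n := [set o | sees_prefixes (16 * V) (omega ^~ o) (eta ^~ o) n].
have half n : ((2^-1)%:E <= P (S n))%E.
  apply: (@le_trans _ _ (P (S n.+1))).
    exact: (sees_prefixes_prob hp heps tp01 V0 HMV M16 rate_window lam0 lam33 lam8 lam_m mass
      rJ0 rJ_p rJ_L rJ_jump (ltn0Sn n) law).
  apply: le_measure; rewrite ?inE; [exact: measurable_sees_prefixes|exact: measurable_sees_prefixes|].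
  by move=> o; exact: sees_prefixesS.
have -> : [set w | words_seen (16 * V) (omega ^~ w) (eta ^~ w) = [set: word]] = \bigcap_n S n.
  apply/seteqP; split => o /=.
    by move=> /words_seenE W n _; exact: W.
  by move=> W; apply/words_seenE => n; exact: W.
have cvgS : P \o S @ \oo --> P (\bigcap_n S n).
  apply: nonincreasing_cvg_mu.
  - by apply: (le_lt_trans (probability_le1 _ _)); rewrite ?ltry//; exact: measurable_sees_prefixes.
  - by move=> n; exact: measurable_sees_prefixes.
  - by apply: bigcapT_measurable => n; exact: measurable_sees_prefixes.
  - by move=> n k nk; apply/subsetPset => o; exact: sees_prefixesS.
apply: (@lt_le_trans _ _ (2^-1)%:E); first by rewrite lte_fin invr_gt0.
rewrite -(cvg_lim _ cvgS)//; apply: lime_ge; first by apply/cvg_ex; eexists; exact: cvgS.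
by apply: nearW => n; exact: half.
Qed.
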